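(* Let $g_{i,j}\in\mathbb{C}[[t_1,\ldots,t_l]]$, $1\le i,j\le n$, be power series with no constant term. Let $f_i$, $1\le i\le n$, denote the eigenvalues of the matrix $A=(g_{i,j})$ and set $N=\dim_{\mathbb{Q}}\langle f_1,\ldots,f_n\rangle_{\mathbb{Q}}$. Then $$\operatorname{tr.d.}_{\mathbb{C}}\,\mathbb{C}(A,E(A))\ \ge\ N+\operatorname{rank} J\big((g_{i,j});\vec t\,\big).$$
   Context: $E(A)=\sum_{r\ge0}A^r/r!$ is the matrix exponential, a matrix over $\mathbb{C}[[t_1,\ldots,t_l]]$ because the entries of $A$ have no constant term. $\mathbb{C}(A,E(A))$ is the subfield of the fraction field of $\mathbb{C}[[t_1,\ldots,t_l]]$ generated over $\mathbb{C}$ by the entries of $A$ and $E(A)$. The eigenvalues $f_i$ are taken in an algebraic closure of that fraction field, and $\langle f_1,\ldots,f_n\rangle_{\mathbb{Q}}$ is their $\mathbb{Q}$-linear span. $J((g_{i,j});\vec t)$ is the $n^2\times l$ Jacobian matrix of partial derivatives $\partial g_{i,j}/\partial t_s$; its rank is taken over the fraction field of $\mathbb{C}[[t_1,\ldots,t_l]]$. *)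

(* Defs.v *)
From HB Require Import structures.
From mathcomp Require Import all_boot all_order all_algebra.
From mathcomp Require Import boolp reals complex mpoly.

Set Implicit Arguments.
Unset Strict Implicit.
Unset Printing Implicit Defensive.

Import Order.TTheory GRing.Theory Num.Theory.
Local Open Scope ring_scope.

(* The ring R[[t_0, ..., t_(l-1)]] of formal power series: a series is its    *)
(* family of coefficients, indexed by the monomials 'X_{1..l} of {mpoly R[l]}.*)
(* The coercion makes [f m] the coefficient of f at the monomial m.           *)
Record fps (l : nat) (R : Type) := FPS { fcoef :> 'X_{1..l} -> R }.

Notation "{ 'fps' R [ l ] }" := (fps l R)
  (at level 0, R at level 2, l at level 2, format "{ 'fps'  R [ l ] }")
  : type_scope.

HB.instance Definition _ (l : nat) (R : Type) := gen_eqMixin {fps R[l]}.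
HB.instance Definition _ (l : nat) (R : Type) := gen_choiceMixin {fps R[l]}.

Lemma fpsP (l : nat) (R : Type) (f g : {fps R[l]}) :
  (forall m, f m = g m) <-> f = g.
Proof.
split=> [|-> //]; case: f g => [f] [g] /= fg.
by congr FPS; apply/funext.
Qed.

Section FpsZmod.
Variables (l : nat) (R : zmodType).
Implicit Types f g h : {fps R[l]}.

Definition fps_zero : {fps R[l]} := FPS (fun=> 0).
Definition fps_opp f : {fps R[l]} := FPS (fun m => - f m).
Definition fps_add f g : {fps R[l]} := FPS (fun m => f m + g m).

Fact fps_addA : associative fps_add.
Proof. by move=> f g h; apply/fpsP=> m /=; rewrite addrA. Qed.
Fact fps_addC : commutative fps_add.
Proof. by move=> f g; apply/fpsP=> m /=; rewrite addrC. Qed.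
Fact fps_add0 : left_id fps_zero fps_add.
Proof. by move=> f; apply/fpsP=> m /=; rewrite add0r. Qed.
Fact fps_addN : left_inverse fps_zero fps_opp fps_add.
Proof. by move=> f; apply/fpsP=> m /=; rewrite addNr. Qed.

HB.instance Definition _ := GRing.isZmodule.Build {fps R[l]}
  fps_addA fps_addC fps_add0 fps_addN.

Lemma fps0E m : (0 : {fps R[l]}) m = 0. Proof. by []. Qed.
Lemma fpsNE f m : (- f) m = - f m. Proof. by []. Qed.
Lemma fpsDE f g m : (f + g) m = f m + g m. Proof. by []. Qed.

Lemma fps_sumE (I : Type) (r : seq I) (P : pred I) (F : I -> {fps R[l]}) m :
  (\sum_(i <- r | P i) F i) m = \sum_(i <- r | P i) F i m.
Proof. by apply: (big_morph (fun f : {fps R[l]} => f m)). Qed.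
End FpsZmod.

Section FpsRing.
Variables (l : nat) (R : comNzRingType).
Implicit Types f g h : {fps R[l]}.

Definition fpsC (c : R) : {fps R[l]} := FPS (fun m => c *+ (m == 0%MM)).
Definition fps_mul f g : {fps R[l]} := FPS (fun m =>
  \sum_(k : 'X_{1..l < (mdeg m).+1, (mdeg m).+1} | m == (k.1 + k.2)%MM)
     f k.1 * g k.2).

(* Truncation to a polynomial; it reduces the ring axioms to {mpoly R[l]}.    *)
Let trunc d f : {mpoly R[l]} := \sum_(m : 'X_{1..l < d}) f m *: 'X_[m].

Let truncE d f m : (mdeg m < d)%N -> (trunc d f)@_m = f m.
Proof. exact: mcoeff_mpoly. Qed.

Let mcoeffM_eq (p p' q q' : {mpoly R[l]}) m :
    (forall k, (mdeg k <= mdeg m)%N -> p@_k = p'@_k) ->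
    (forall k, (mdeg k <= mdeg m)%N -> q@_k = q'@_k) ->
  (p * q)@_m = (p' * q')@_m.
Proof.
move=> pE qE; rewrite !mcoeffM; apply: eq_bigr => k _.
by rewrite pE ?qE // -ltnS; apply: bmdeg.
Qed.

Let fps_mulE d f g m : (mdeg m < d)%N ->
  fps_mul f g m = (trunc d f * trunc d g)@_m.
Proof.
move=> md; rewrite mcoeffM /=; apply: eq_bigr => k _.
by rewrite !truncE // (leq_trans _ md) // bmdeg.
Qed.

Fact fps_mulA : associative fps_mul.
Proof.
move=> f g h; apply/fpsP=> m; rewrite !(fps_mulE (d := (mdeg m).+1)) //.
transitivity ((trunc (mdeg m).+1 f *
  (trunc (mdeg m).+1 g * trunc (mdeg m).+1 h))@_m).
  by apply: mcoeffM_eq => // k km; rewrite truncE // -fps_mulE.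
by rewrite mulrA; apply: mcoeffM_eq => // k km; rewrite truncE // -fps_mulE.
Qed.

Fact fps_mulC : commutative fps_mul.
Proof.
move=> f g; apply/fpsP=> m.
by rewrite !(fps_mulE (d := (mdeg m).+1)) // mulrC.
Qed.

Fact fps_mul1 : left_id (fpsC 1) fps_mul.
Proof.
move=> f; apply/fpsP=> m; rewrite (fps_mulE (d := (mdeg m).+1)) //.
transitivity ((1 * trunc (mdeg m).+1 f)@_m); last by rewrite mul1r truncE.
by apply: mcoeffM_eq => // k km; rewrite truncE // mcoeff1.
Qed.

Fact fps_mulDl : left_distributive fps_mul +%R.
Proof.
move=> f g h; apply/fpsP=> m /=; rewrite -big_split /=.
by apply: eq_bigr => k _; rewrite mulrDl.
Qed.

Fact fps_oner_neq0 : fpsC 1 != 0.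
Proof.
apply/eqP=> /fpsP/(_ 0%MM)/eqP; rewrite fps0E /= eqxx.
by rewrite oner_eq0.
Qed.

HB.instance Definition _ := GRing.Zmodule_isComNzRing.Build {fps R[l]}
  fps_mulA fps_mulC fps_mul1 fps_mulDl fps_oner_neq0.

Lemma fps1E m : (1 : {fps R[l]}) m = (m == 0%MM)%:R.
Proof. by []. Qed.

Lemma fpsME f g m : (f * g) m =
  \sum_(k : 'X_{1..l < (mdeg m).+1, (mdeg m).+1} | m == (k.1 + k.2)%MM)
     f k.1 * g k.2.
Proof. by []. Qed.

Definition fps_unit : pred {fps R[l]} := fun f => `[< exists g, g * f = 1 >].
Definition fps_inv f : {fps R[l]} :=
  if pselect (exists g, g * f = 1) is left fU then projT1 (cid fU) else f.

Fact fps_mulVr : {in fps_unit, left_inverse 1 fps_inv *%R}.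
Proof.
move=> f /asboolP fU; rewrite /fps_inv; case: pselect => // {}fU.
by case: (cid fU).
Qed.

Fact fps_unitP f g : g * f = 1 -> fps_unit f.
Proof. by move=> gf; apply/asboolP; exists g. Qed.

Fact fps_inv_out : {in [predC fps_unit], fps_inv =1 id}.
Proof.
move=> f; rewrite inE /= => /asboolP fNU.
by rewrite /fps_inv; case: pselect.
Qed.

HB.instance Definition _ := GRing.ComNzRing_hasMulInverse.Build {fps R[l]}
  fps_mulVr fps_unitP fps_inv_out.

Definition fps_deriv (s : 'I_l) f : {fps R[l]} :=
  FPS (fun m => f (m + U_(s))%MM *+ (m s).+1).
End FpsRing.

Section FpsDomain.
Variables (l : nat) (R : idomainType).
Implicit Types f g : {fps R[l]}.

Let fps_lead f : f != 0 ->
  exists2 m, f m != 0 & forall k : 'X_{1..l}, (k < m)%O -> f k = 0.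
Proof.
move=> f0; apply: contrapT => noM; case/eqP: f0; apply/fpsP=> m.
rewrite fps0E; move: m; apply: ltmwf => m IH; apply: contrapT => /eqP fm.
by apply: noM; exists m.
Qed.

Fact fps_mulf_eq0 f g : f * g = 0 -> (f == 0) || (g == 0).
Proof.
move=> fg0; apply: contraT; rewrite negb_or.
case/andP=> /fps_lead[a fa aP] /fps_lead[b gb bP].
have aD : (mdeg a < (mdeg (a + b)%MM).+1)%N by rewrite mdegD ltnS leq_addr.
have bD : (mdeg b < (mdeg (a + b)%MM).+1)%N by rewrite mdegD ltnS leq_addl.
move/fpsP: fg0 => /(_ (a + b)%MM)/eqP.
rewrite fps0E fpsME (bigD1 (BMultinom aD, BMultinom bD)) //= big1.
  by rewrite addr0 mulf_eq0 (negPf fa) (negPf gb).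
move=> [[a' a'D] [b' b'D]] /= /andP[/eqP abE ne].
case: (ltgtP a' a) => [lt|gt|eq].
- by rewrite aP ?mul0r.
- rewrite (bP b') ?mulr0 // ltNge; apply/negP => le.
  by have := ltmc_le_add gt le; rewrite abE ltxx.
have bE : b' = b.
  by apply/eqP; rewrite -(eqm_add2l a) -{1}eq eq_sym; apply/eqP.
by case/negP: ne; rewrite xpair_eqE -!val_eqE /= eq bE !eqxx.
Qed.

HB.instance Definition _ := GRing.ComUnitRing_isIntegral.Build {fps R[l]}
  fps_mulf_eq0.
End FpsDomain.

Section MatrixExp.
Variables (l n : nat) (F : fieldType).
Implicit Types A : 'M[{fps F[l]}]_n.

(* When the entries of A have no constant term, those of A ^+ r have order at *)
(* least r, so A ^+ r / r! contributes to the coefficient of m in E(A) only   *)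
(* for r <= mdeg m; mexp_stable checks that cutting the exponential sum at    *)
(* any later index gives the same coefficient.                                *)
Definition mexp A : 'M[{fps F[l]}]_n := \matrix_(i, j) FPS (fun m =>
  \sum_(r < (mdeg m).+1) (r`!%:R)^-1 * (A ^+ r) i j m).

Lemma expmx_order A (r : nat) i j m :
  (forall i j, A i j 0%MM = 0) -> (mdeg m < r)%N -> (A ^+ r) i j m = 0.
Proof.
move=> A0; elim: r i j m => // r IH i j m mr.
rewrite exprS mxE fps_sumE big1 // => k _; rewrite fpsME big1 // => -[m1 m2] /=.
move/eqP=> mE; have [->|m1_neq0] := eqVneq (m1 : 'X_{1..l}) 0%MM.
  by rewrite A0 mul0r.
have mD : mdeg m = (mdeg m1 + mdeg m2)%N by rewrite -mdegD; congr mdeg.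
rewrite IH ?mulr0 // -ltnS; apply: leq_trans mr.
by rewrite ltnS [X in (_ < X)%N]mD -[X in (X < _)%N]add0n ltn_add2r lt0n mdeg_eq0.
Qed.

Lemma mexp_stable A i j m d : (forall i j, A i j 0%MM = 0) -> (mdeg m < d)%N ->
  mexp A i j m = \sum_(r < d) (r`!%:R)^-1 * (A ^+ r) i j m.
Proof.
move=> A0 md; rewrite mxE /=.
rewrite (big_ord_widen d (fun r => (r`!%:R)^-1 * (A ^+ r) i j m)) //.
rewrite big_mkcond; apply: eq_bigr => r _; case: ifPn => //.
by rewrite -leqNgt => mr; rewrite expmx_order ?mulr0.
Qed.

(* The row of index mxvec_index i j holds the partial derivatives of A i j.   *)
Definition jacobian A : 'M[{fraction {fps F[l]}}]_(n * n, l) :=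
  \matrix_(k < n * n, s < l) tofrac (fps_deriv s (mxvec A 0 k)).
End MatrixExp.

Section FieldExtensions.
Variables (F K : fieldType) (iota : F -> K).

(* F(S): the subfield of K generated by the image of F and the set S.         *)
Inductive adjoin (S : K -> Prop) : K -> Prop :=
| adjoin_base c : adjoin S (iota c)
| adjoin_gen x : S x -> adjoin S x
| adjoin_sub x y : adjoin S x -> adjoin S y -> adjoin S (x - y)
| adjoin_mul x y : adjoin S x -> adjoin S y -> adjoin S (x * y)
| adjoin_inv x : adjoin S x -> adjoin S x^-1.

Definition alg_free d (x : 'I_d -> K) : Prop :=
  forall p : {mpoly F[d]}, mmap iota x p = 0 -> p = 0.

Definition alg_over (E : K -> Prop) (y : K) : Prop :=
  exists p : {poly K}, [/\ p != 0, forall i, E p`_i & root p y].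

(* The subfield E of K has a transcendence basis of d elements over F.        *)
Definition has_trdeg (E : K -> Prop) (d : nat) : Prop :=
  exists x : 'I_d -> K,
    [/\ forall i, E (x i),
        alg_free x
      & forall y, E y -> alg_over (adjoin (fun z => exists i, z = x i)) y].
End FieldExtensions.

(* C(A, E(A)) inside the fraction field of C[[t_0, ..., t_(l-1)]].            *)
Definition field_mx_exp l n (F : fieldType) (A : 'M[{fps F[l]}]_n) :
    {fraction {fps F[l]}} -> Prop :=
  adjoin (fun c : F => tofrac (fpsC l c))
    (fun y => exists i j, y = tofrac (A i j) \/ y = tofrac (mexp A i j)).

Section RationalSpan.
Variable L : fieldType.

Definition Qspan n (f : 'I_n -> L) (y : L) : Prop :=
  exists c : 'I_n -> rat, y = \sum_i ratr (c i) * f i.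

Definition Qfree n (f : 'I_n -> L) : Prop :=
  forall c : 'I_n -> rat, \sum_i ratr (c i) * f i = 0 -> forall i, c i = 0.

Definition has_Qdim (V : L -> Prop) (N : nat) : Prop :=
  exists b : 'I_N -> L, Qfree b /\ forall y, V y <-> Qspan b y.
End RationalSpan.

(* Main.v *)
Require Import Defs.
From HB Require Import structures.
From mathcomp Require Import all_boot all_order all_algebra.
From mathcomp Require Import boolp reals complex mpoly.
From mathcomp Require Import perm separable closed_field ring.

Set Implicit Arguments.
Unset Strict Implicit.
Unset Printing Implicit Defensive.

Import Order.TTheory GRing.Theory Num.Theory.
Local Open Scope ring_scope.

(** Let K be the fraction field of F[[t_1, ..., t_l]], where F is the field of
complex numbers. The derivations D_s = d/dt_s of K extend to its algebraic
closure L, and the only elements of L which they all kill are those of F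
([fps_algebraic_derivations]).

Let E be the algebraic closure of F(A, E(A)) in L and x_1, ..., x_d a
transcendence basis of E over F. The partial derivations del_j = d/dx_j act on
E, and dy = (del_j y)_j identifies the differentials of E over F with E^d. Every
derivation of E over F is determined by its values at the x_j, so that
D_s y = \sum_j (del_j y) (D_s x_j). In particular the Jacobian matrix of A is the
product of a matrix with d columns by T = (D_s x_j), and its rank is at most
that of T.

Each eigenvalue f of A lies in E, and so does its exponential: there is an
eigenvalue e of E(A) with D_s e = e D_s f for all s ([eigenvalue_exp]). To find
it, let chi be the characteristic polynomial of A and H the remainder of exp(X)
modulo chi ^ 2. This makes sense because chi is X ^ n modulo the t_s, so that
the remainders of the X ^ r tend to 0. Then H(A) = E(A) by Cayley-Hamilton, while
the derivative of H is H modulo chi and D_s kills H modulo chi, so e = H(f) will do.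
Scaling a basis of the Q-span of the eigenvalues hence gives N integral
combinations y_i of them, free over Q, and elements z_i of E such that
D_s z_i = z_i D_s y_i.

The differential forms omega_i = dy_i - dz_i / z_i are the rows of an N x d
matrix W with W T = 0. Therefore rank T <= d - rank W, and the theorem follows once
the omega_i are known to be linearly independent ([abstract_ax]). The proof of
this is due to Ax.

First, the omega_i are closed forms, so a shortest relation \sum_i c_i omega_i = 0
is differentiated by the derivations that kill all the omega_i into a shorter
one; these derivations thus kill the c_i, hence so do the D_s and the c_i are in F.

Secondly, such a relation reads \sum_i c_i dz_i / z_i = dv. Let m be a nonzero
integral vector orthogonal to all the integral relations between the c_i and
w = \prod_i z_i ^ m_i. If del_j w were nonzero, then E would be algebraic over
k(w), where k is the kernel of del_j. Taking norms and traces down to k(w),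
and then residues at w = 0, yields integers q_i, the orders of the norms of the
z_i, such that \sum_i c_i q_i = 0 while \sum_i m_i q_i is the order of the norm of w,
which is positive ([residue_theorem]). This contradicts the choice of m, so w
is in F and D_s kills \sum_i m_i y_i for all s. This combination of eigenvalues is
then a constant, and that constant is 0 as the eigenvalues vanish at t = 0
([eigenvalue_combination]); this contradicts the freeness of the y_i. *)

(** * Derivations *)

(** The values of D lie in an extension of A, because the derivations d/dt_s of
power series do not map the field E of the proof to itself. *)
Definition is_deriv (A L : comNzRingType) (phi D : A -> L) :=
  (forall a b, D (a + b) = D a + D b) /\
  (forall a b, D (a * b) = phi a * D b + phi b * D a).

Section DerivTheory.
Variables (A L : comNzRingType) (phi : {rmorphism A -> L}) (D : A -> L).
Hypothesis derD : is_deriv phi D.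

Lemma derivationD a b : D (a + b) = D a + D b.
Proof. by case: derD. Qed.

Lemma derivationM a b : D (a * b) = phi a * D b + phi b * D a.
Proof. by case: derD. Qed.

Lemma derivation0 : D 0 = 0.
Proof. by apply: (addrI (D 0)); rewrite -derivationD !addr0. Qed.

Lemma derivationN a : D (- a) = - D a.
Proof. by apply/eqP; rewrite -addr_eq0 -derivationD addNr derivation0. Qed.

Lemma derivationB a b : D (a - b) = D a - D b.
Proof. by rewrite derivationD derivationN. Qed.

Lemma derivation1 : D 1 = 0.
Proof.
apply: (addrI (D 1)); rewrite addr0 -{3}[1](mulr1 1) derivationM rmorph1.
by rewrite !mul1r.
Qed.

Lemma derivation_sum (I : Type) (r : seq I) (P : pred I) (F : I -> A) :
  D (\sum_(i <- r | P i) F i) = \sum_(i <- r | P i) D (F i).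
Proof. exact: (big_morph D derivationD derivation0). Qed.

Lemma derivationMn a n : D (a *+ n) = D a *+ n.
Proof. by elim: n => [|n IH]; rewrite ?derivation0 // !mulrS derivationD IH. Qed.

Lemma derivation_nat n : D n%:R = 0.
Proof. by rewrite derivationMn derivation1 mul0rn. Qed.

Lemma derivationX a n : D (a ^+ n) = (phi a ^+ n.-1 * D a) *+ n.
Proof.
elim: n => [|n IH]; first by rewrite expr0 derivation1 mulr0n.
rewrite exprS derivationM IH rmorphXn /= mulrSr; congr (_ + _).
case: n {IH} => [|n]; first by rewrite !mulr0n mulr0.
by rewrite mulrnAr mulrA -exprS.
Qed.

(** Here and below [D a = phi a * u] says that u is the logarithmic derivative
of a, in a form which makes sense for a = 0 and does not require inverses. *)
Lemma logderivX a u n : D a = phi a * u -> D (a ^+ n) = phi (a ^+ n) * (u *+ n).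
Proof.
move=> Da; rewrite derivationX Da rmorphXn /=; case: n => [|n].
  by rewrite !mulr0n mulr0.
by rewrite mulrA -exprSr mulrnAr.
Qed.

Lemma logderiv_prod (I : Type) (r : seq I) (F : I -> A) (u : I -> L) :
  (forall i, D (F i) = phi (F i) * u i) ->
  D (\prod_(i <- r) F i) = phi (\prod_(i <- r) F i) * \sum_(i <- r) u i.
Proof.
move=> Fu; elim: r => [|i r IH]; first by rewrite !big_nil derivation1 mulr0.
by rewrite !big_cons derivationM IH Fu rmorphM /= mulrDr !mulrA addrC
     [phi _ * phi (F i)]mulrC.
Qed.
End DerivTheory.

Section DerivInv.
Variables (A L : fieldType) (phi : {rmorphism A -> L}) (D : A -> L).
Hypothesis derD : is_deriv phi D.

Lemma derivation_div a b :
  b != 0 -> D (a / b) = (D a * phi b - phi a * D b) / phi b ^+ 2.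
Proof.
move=> b0; have pb0 : phi b != 0 by rewrite fmorph_eq0.
have aE : a = b * (a / b) by rewrite mulrC divfK.
have := derivationM derD b (a / b); rewrite -aE fmorph_div => ->.
by field.
Qed.

Lemma derivationV a : D a^-1 = - (D a / phi a ^+ 2).
Proof.
have [->|a0] := eqVneq a 0.
  by rewrite invr0 (derivation0 derD) mul0r oppr0.
rewrite -[a^-1]mul1r derivation_div // (derivation1 derD) mul0r sub0r.
by rewrite rmorph1 mul1r mulNr.
Qed.

Lemma logderivV a u : D a = phi a * u -> D a^-1 = phi a^-1 * - u.
Proof.
move=> Da; rewrite derivationV Da; have [->|a0] := eqVneq a 0.
  by rewrite invr0 !rmorph0 !mul0r oppr0.
by rewrite fmorphV; field; rewrite fmorph_eq0.
Qed.
End DerivInv.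

(** The coefficientwise extension of D is the part of the chain rule that does
not differentiate the variable. *)
Lemma map_poly_derivation (A L : comNzRingType) (phi : {rmorphism A -> L}) (D : A -> L) :
  is_deriv phi D -> is_deriv (map_poly phi) (map_poly D).
Proof.
move=> derD; have D0 := derivation0 derD; split=> p q; apply/polyP=> i.
  by rewrite coefD !coef_map_id0 // coefD (derivationD derD).
rewrite [map_poly phi q * _]mulrC coefD coef_map_id0 // !coefM (derivation_sum derD).
rewrite -big_split; apply: eq_bigr => j _ /=; rewrite (derivationM derD).
by rewrite !coef_map_id0 ?rmorph0 //; congr (_ + _); rewrite mulrC.
Qed.

Section Chain.
Variables (F E L : comNzRingType).
Variables (phi : {rmorphism F -> E}) (iota : {rmorphism E -> L}) (D : E -> L).
Hypothesis derD : is_deriv iota D.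

Lemma derivation_horner (p : {poly F}) y :
  D (map_poly phi p).[y] = (map_poly (D \o phi) p).[iota y]
    + (map_poly (iota \o phi) p^`()).[iota y] * D y.
Proof.
have D0 := derivation0 derD.
have cE q : (map_poly (iota \o phi) q).[iota y] = iota (map_poly phi q).[y].
  by rewrite map_poly_comp horner_map.
elim/poly_ind: p => [|p c IH].
  by rewrite deriv0 !raddf0 !map_poly0 !horner0 D0 mul0r addr0.
rewrite derivD derivC addr0 derivM derivX mulr1.
have -> : map_poly (D \o phi) (p * 'X + c%:P)
    = map_poly (D \o phi) p * 'X + (D (phi c))%:P.
  apply/polyP=> i; rewrite coef_map_id0 /= ?rmorph0 // !coefD !coefMX !coefC.
  by case: i => [|i] /=; rewrite ?add0r ?addr0 // coef_map_id0 /= ?rmorph0.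
rewrite !rmorphD !rmorphM /= !map_polyX map_polyC /= !hornerE.
rewrite (derivationD derD) (derivationM derD) IH.
rewrite !cE; ring.
Qed.
End Chain.

Section MinimalPolynomial.
Variables (F L : fieldType) (phi : {rmorphism F -> L}).
Hypothesis F0 : [pchar F] =i pred0.

Lemma deriv_eq0 (p : {poly F}) : (1 < size p)%N -> p^`() != 0.
Proof.
move=> p1; apply/eqP=> /polyP/(_ (size p).-2)/eqP; rewrite coef_deriv coef0.
rewrite prednK -?subn1 ?subn_gt0 //; have/pcharf0P F0' := F0.
rewrite -mulr_natr mulf_eq0 F0' subn_eq0 leqNgt p1 orbF subn1.
by rewrite -lead_coefE lead_coef_eq0 -size_poly_eq0 -leqn0 leqNgt ltnW.
Qed.

(** The last property is separability: the derivative of the minimal polynomial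
is a nonzero polynomial of smaller degree. It determines the values of
derivations at y. *)
Lemma minimal_polyP y : algebraicOver phi y ->
  exists p : {poly F}, [/\ p \is monic, root (map_poly phi p) y,
    forall q, root (map_poly phi q) y -> p %| q
  & (map_poly phi p^`()).[y] != 0].
Proof.
case=> p0 p0nz p0y.
pose P n := `[< exists p : {poly F}, [/\ p != 0, root (map_poly phi p) y & size p = n] >].
have exP : exists n, P n by exists (size p0); apply/asboolP; exists p0.
case: (ex_minnP exP) => n /asboolP[p [pnz py sp]] nmin.
have dvdq q : root (map_poly phi q) y -> p %| q.
  move=> qy; rewrite /dvdp; apply/negPn/negP=> rnz.
  have /nmin : P (size (q %% p)).
    apply/asboolP; exists (q %% p); split=> //; move: qy.
    rewrite [in map_poly phi q](divp_eq q p) rmorphD rmorphM /= !rootE !hornerE.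
    by rewrite (rootP py) mulr0 add0r.
  by rewrite -sp leqNgt ltn_modp pnz.
have s1 : (1 < size p)%N.
  rewrite ltnNge; apply/negP=> /size1_polyC pC; move: py pnz.
  by rewrite pC map_polyC /= rootC fmorph_eq0 polyC_eq0 => ->.
pose q := (lead_coef p)^-1 *: p.
have lnz : (lead_coef p)^-1 != 0 by rewrite invr_eq0 lead_coef_eq0.
exists q; split.
- by rewrite monicE lead_coefZ mulVf // lead_coef_eq0.
- by rewrite map_polyZ rootZ // fmorph_eq0.
- by move=> r /dvdq; rewrite dvdpZl.
rewrite derivZ map_polyZ hornerZ mulf_neq0 ?fmorph_eq0 //.
apply/negP=> /dvdq /dvdp_leq; rewrite deriv_eq0 // => /(_ isT).
by rewrite leqNgt lt_size_deriv.
Qed.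
End MinimalPolynomial.

(** The chain rule, applied to the minimal polynomial of y, is a linear equation
for the derivative of y. *)
Lemma derivation_unique (F E L : fieldType) (phi : {rmorphism F -> E})
    (iota : {rmorphism E -> L}) (D1 D2 : E -> L) y :
  [pchar F] =i pred0 -> is_deriv iota D1 -> is_deriv iota D2 ->
  (forall c, D1 (phi c) = D2 (phi c)) -> algebraicOver phi y -> D1 y = D2 y.
Proof.
move=> F0 d1 d2 D12 /(minimal_polyP F0)[p [_ py _ dpy]].
have := derivation_horner phi d1 p y; have := derivation_horner phi d2 p y.
rewrite (rootP py) (derivation0 d1) (derivation0 d2).
have -> : map_poly (D1 \o phi) p = map_poly (D2 \o phi) p.
  by apply: eq_map_poly => c /=.
move=> e1 e2; move: e1; rewrite {}e2 => /addrI/eqP.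
rewrite map_poly_comp horner_map.
by move/eqP/mulfI; apply; rewrite fmorph_eq0.
Qed.

(** For y algebraic over F, [lift y w] says that w is an admissible value of the
derivative of y: it satisfies the equations obtained by differentiating all the
algebraic equations of y over F. The minimal polynomial provides exactly one
such w. *)
Section AlgebraicExtension.
Variables (F L : fieldType) (phi : {rmorphism F -> L}) (D : F -> L).
Hypotheses (F0 : [pchar F] =i pred0) (derD : is_deriv phi D).

Let Delta z w (q : {poly F}) := (map_poly D q).[z] + (map_poly phi q^`()).[z] * w.
Let ev z (q : {poly F}) := (map_poly phi q).[z].
Let lift y w := forall q, root (map_poly phi q) y -> Delta y w q = 0.

Let D0 := derivation0 derD.

Let mapDC c : map_poly D c%:P = (D c)%:P.
Proof. by apply/polyP=> i; rewrite coef_map_id0 // !coefC; case: ifP. Qed.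

Let mapD0 : map_poly D 0 = 0.
Proof. by rewrite -polyC0 mapDC D0. Qed.

Let DeltaD z w p q : Delta z w (p + q) = Delta z w p + Delta z w q.
Proof.
rewrite /Delta derivD rmorphD.
by rewrite (derivationD (map_poly_derivation derD)) !hornerD; ring.
Qed.

Let DeltaM z w p q : Delta z w (p * q) = ev z p * Delta z w q + ev z q * Delta z w p.
Proof.
rewrite /Delta /ev derivM rmorphD !rmorphM /=.
rewrite (derivationM (map_poly_derivation derD)) /=.
by rewrite !hornerE; ring.
Qed.

Let ev_morph z := horner_eval z \o map_poly phi.

Let lift_ex y : algebraicOver phi y -> exists w, lift y w.
Proof.
case/(minimal_polyP F0)=> p [_ py pdvd dpy].
exists (- ((map_poly D p).[y] / (map_poly phi p^`()).[y])) => q /pdvd/dvdpP[r ->].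
rewrite DeltaM /ev (rootP py) mul0r addr0 /Delta mulrN [X in _ - X]mulrC divfK //.
by rewrite subrr mulr0.
Qed.

Let lift_uniq y w w' : algebraicOver phi y -> lift y w -> lift y w' -> w = w'.
Proof.
case/(minimal_polyP F0)=> p [_ py pdvd dpy] /(_ _ py) e /(_ _ py).
by rewrite -e => /addrI/(mulfI dpy).
Qed.

(** The map [Delta z w] is a derivation on polynomials along evaluation at z.
The chain rule for it shows that an admissible value at z determines one at
each element of F[z]. *)
Let lift_horner z w q : lift z w -> lift (ev z q) (Delta z w q).
Proof.
move=> zw r rz.
have dDelta : is_deriv (ev_morph z) (Delta z w).
  by split=> p1 p2; [exact: DeltaD | exact: DeltaM].
have evE (r' : {poly F}) :
    (map_poly (ev_morph z \o polyC) r').[ev z q] = (map_poly phi r').[ev z q].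
  congr (_.[_]); apply: eq_map_poly => c; rewrite /= /ev_morph /=.
  by rewrite map_polyC horner_evalE hornerC.
have := derivation_horner polyC dDelta r q.
rewrite -/(comp_poly q r) zw; last by rewrite map_comp_poly rootE horner_comp.
move/esym; rewrite /= evE => <-; rewrite {1}/Delta; congr (_.[_] + _).
apply/polyP=> i; rewrite !coef_map_id0 //= /Delta.
  by rewrite derivC rmorph0 horner0 mul0r addr0 mapDC hornerC.
by rewrite deriv0 !rmorph0 !horner0 mul0r addr0 mapD0 horner0.
Qed.

(** To compare the derivatives of x, y and x + y or x * y, express them all as
polynomials in a primitive element z. The last clause gives the values of the
extension explicitly, to show that they stay in a given subfield. *)
Lemma derivation_extension : exists D' : L -> L,
  [/\ forall c, D' (phi c) = D c,
      forall x y, algebraicOver phi x -> algebraicOver phi y ->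
        D' (x + y) = D' x + D' y,
      forall x y, algebraicOver phi x -> algebraicOver phi y ->
        D' (x * y) = x * D' y + y * D' x
    & forall y, algebraicOver phi y -> exists w1 w2 : {poly F},
        D' y = (map_poly D w1).[y] / (map_poly phi w2).[y]].
Proof.
have liftE y : exists w, algebraicOver phi y -> lift y w.
  have [/lift_ex[w yw]|nalg] := pselect (algebraicOver phi y); first by exists w.
  by exists 0 => /nalg.
have [D' D'P] := choice liftE; exists D'.
have common x y : algebraicOver phi x -> algebraicOver phi y ->
    exists z w p q, [/\ lift z w, x = ev z p & y = ev z q].
  move=> ax ay; case: (ax) (ay) => [p pnz px] [q qnz qy].
  have [n [[r rE] [s sE]]] := pchar0_PET pnz px qnz qy F0.
  have az : algebraicOver phi (y *+ n - x).
    apply: algebraic_sub ax; elim: (n) => [|k IH]; first exact: algebraic0.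
    by rewrite mulrS; apply: algebraic_add.
  by have [w zw] := lift_ex az; exists (y *+ n - x), w, r, s.
split=> [c|x y ax ay|x y ax ay|y ay].
- apply: (lift_uniq (algebraic_id phi c)); first exact/D'P/algebraic_id.
  have /lift_ex[w zw] := algebraic0 phi.
  have := lift_horner (q := c%:P) zw.
  by rewrite /ev /Delta map_polyC derivC rmorph0 horner0 mul0r addr0 mapDC !hornerC.
- have [z [w [p [q [zw xE yE]]]]] := common x y ax ay.
  have -> : D' x = Delta z w p.
    by apply: (lift_uniq ax (D'P _ ax)); rewrite xE; apply: lift_horner.
  have -> : D' y = Delta z w q.
    by apply: (lift_uniq ay (D'P _ ay)); rewrite yE; apply: lift_horner.
  have axy := algebraic_add ax ay.
  apply: (lift_uniq axy (D'P _ axy)); rewrite -DeltaD xE yE.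
  have -> : ev z p + ev z q = ev z (p + q) by rewrite /ev rmorphD hornerD.
  exact: lift_horner.
- have [z [w [p [q [zw xE yE]]]]] := common x y ax ay.
  have -> : D' x = Delta z w p.
    by apply: (lift_uniq ax (D'P _ ax)); rewrite xE; apply: lift_horner.
  have -> : D' y = Delta z w q.
    by apply: (lift_uniq ay (D'P _ ay)); rewrite yE; apply: lift_horner.
  have axy := algebraic_mul ax ay.
  apply: (lift_uniq axy (D'P _ axy)); rewrite xE yE -DeltaM.
  have -> : ev z p * ev z q = ev z (p * q) by rewrite /ev rmorphM hornerM.
  exact: lift_horner.
have [p [_ py pdvd dpy]] := minimal_polyP F0 ay.
exists p, (- p^`()).
have := D'P _ ay _ py; rewrite /Delta => /eqP; rewrite addrC addr_eq0 => /eqP e.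
by rewrite rmorphN hornerN invrN mulrN -mulNr -e mulrC mulKf.
Qed.
End AlgebraicExtension.

Section FractionExtension.
Variables (S : idomainType) (L : fieldType) (psi : {rmorphism S -> L}).

Lemma fraction_elim (x : {fraction S}) :
  exists r : S * S, r.2 != 0 /\ x = tofrac r.1 / tofrac r.2.
Proof.
elim/quotW: x => r; exists (frac r); split; first exact: denom_ratioP.
have d0 : (frac r).2 != 0 by exact: denom_ratioP.
apply: (canRL (mulfK _)); first by rewrite tofrac_eq0.
rewrite /FracField.tofrac; unlock FracField.tofrac; rewrite -[LHS]FracField.pi_mul.
apply/eqmodP; rewrite /= FracField.equivfE /FracField.mulf /=.
by rewrite !numden_Ratio ?mulr1 ?oner_eq0 // mulrC.
Qed.

(** The chosen representation is arbitrary, and the definitions that use it are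
shown not to depend on it. *)
Definition frac_rep x := projT1 (cid (fraction_elim x)).

(** The proof of injectivity is an argument so that [frac_map] can be declared
as a ring morphism. *)
Definition frac_map of injective psi := fun x => psi (frac_rep x).1 / psi (frac_rep x).2.

Hypothesis psi_inj : injective psi.
Local Notation phi := (frac_map psi_inj).

Let nz b : b != 0 -> psi b != 0.
Proof. by rewrite -(inj_eq psi_inj) rmorph0. Qed.

Lemma frac_repP x : (frac_rep x).2 != 0 /\
  x = tofrac (frac_rep x).1 / tofrac (frac_rep x).2.
Proof. exact: (projT2 (cid (fraction_elim x))). Qed.

Lemma fraction_eq (a b c d : S) : b != 0 -> d != 0 ->
  (tofrac a / tofrac b == tofrac c / tofrac d) = (a * d == c * b).
Proof.
move=> b0 d0; rewrite eqr_div ?tofrac_eq0 // -!tofracM tofrac_eq.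
by [].
Qed.

Lemma frac_mapE a b : b != 0 -> phi (tofrac a / tofrac b) = psi a / psi b.
Proof.
move=> b0; rewrite /frac_map; case: (frac_repP (tofrac a / tofrac b)).
case: frac_rep => c d /= d0 /eqP; rewrite fraction_eq // => /eqP e.
by apply/eqP; rewrite eqr_div ?nz // -!rmorphM e.
Qed.

Lemma frac_map_tofrac a : phi (tofrac a) = psi a.
Proof.
by rewrite -[tofrac a]divr1 -tofrac1 frac_mapE ?oner_eq0 // rmorph1 divr1.
Qed.

Fact frac_map_additive : zmod_morphism phi.
Proof.
move=> x y; have [/= b0 ->] := frac_repP x; have [/= d0 ->] := frac_repP y.
rewrite -mulNr -tofracN addf_div ?tofrac_eq0 // -!tofracM -tofracD.
rewrite !frac_mapE ?mulf_neq0 // rmorphD !rmorphM rmorphN /=.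
by field; rewrite !nz.
Qed.

Fact frac_map_multiplicative : monoid_morphism phi.
Proof.
split=> [|x y]; first by rewrite -tofrac1 frac_map_tofrac rmorph1.
have [/= b0 ->] := frac_repP x; have [/= d0 ->] := frac_repP y.
rewrite mulf_div -!tofracM !frac_mapE ?mulf_neq0 // !rmorphM /=.
by rewrite mulf_div.
Qed.

HB.instance Definition _ :=
  GRing.isZmodMorphism.Build {fraction S} L phi frac_map_additive.
HB.instance Definition _ :=
  GRing.isMonoidMorphism.Build {fraction S} L phi frac_map_multiplicative.

Variable D : S -> L.
Hypothesis derD : is_deriv psi D.

(** The quotient rule; the work is to check that it is compatible with the
equality of fractions. *)
Lemma fraction_derivation : exists D' : {fraction S} -> L,
  is_deriv phi D' /\ forall a, D' (tofrac a) = D a.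
Proof.
pose d (a b : S) := (D a * psi b - psi a * D b) / psi b ^+ 2.
pose D' x := d (frac_rep x).1 (frac_rep x).2.
have D'E a b : b != 0 -> D' (tofrac a / tofrac b) = d a b.
  move=> b0; rewrite /D'; case: (frac_repP (tofrac a / tofrac b)).
  case: frac_rep => c e /= e0 /eqP; rewrite fraction_eq // => /eqP E.
  have pE : psi a * psi e = psi c * psi b by rewrite -!rmorphM E.
  have := congr1 D E; rewrite !(derivationM derD) => dE.
  apply/eqP; rewrite /d eqr_div ?expf_neq0 ?nz //; apply/eqP.
  have pc : psi c = psi a * psi e / psi b by rewrite pE mulfK ?nz.
  have dc : D c = (psi a * D e + psi e * D a - psi c * D b) / psi b.
    by rewrite dE addrC addKr mulrC mulKf ?nz.
  by rewrite dc pc; field; rewrite nz.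
exists D'; split; last first.
  move=> a; rewrite -[tofrac a]divr1 -tofrac1 D'E ?oner_eq0 // /d rmorph1.
  by rewrite (derivation1 derD) mulr0 subr0 mulr1 expr1n divr1.
split=> x y; have [/= b0 ->] := frac_repP x; have [/= d0 ->] := frac_repP y.
  rewrite addf_div ?tofrac_eq0 // -!tofracM -tofracD !D'E ?mulf_neq0 // /d.
  rewrite (derivationD derD) !(derivationM derD) rmorphD !rmorphM /=.
  by field; rewrite !nz.
rewrite mulf_div -!tofracM !D'E ?mulf_neq0 // !frac_mapE // /d.
rewrite !(derivationM derD) !rmorphM /=.
by field; rewrite !nz.
Qed.
End FractionExtension.

(** * Symmetric functions of conjugates *)

Lemma mpoly_morph_eq n (k L : comNzRingType) (f g : {rmorphism {mpoly k[n]} -> L}) :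
  (forall c, f c%:MP = g c%:MP) -> (forall i, f 'X_i = g 'X_i) -> f =1 g.
Proof.
move=> fgC fgX P; rewrite (mpolyE P) !rmorph_sum; apply: eq_bigr => m _.
rewrite -mul_mpolyC !rmorphM /= fgC mpolyXE_id !rmorph_prod; congr (_ * _).
by apply: eq_bigr => i _; rewrite !rmorphXn /= fgX.
Qed.

(** By the fundamental theorem P is a polynomial T in the elementary symmetric
functions, whose values at the roots are, up to sign, the coefficients of p. It
matters that T does not depend on the roots: T will be evaluated both at a
polynomial with power series coefficients and at its reduction modulo the
variables. *)
Lemma symmetric_eval (k : comNzRingType) n (P : {mpoly k[n]}) :
  P \is symmetric -> exists T : {mpoly k[n]},
  forall (S : comNzRingType) (L : idomainType) (kappa : {rmorphism k -> S})
      (phi : {rmorphism S -> L}) (theta : 'I_n -> L) (p : {poly S}),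
    map_poly phi p = \prod_(i < n) ('X - (theta i)%:P) ->
  mmap (phi \o kappa) theta P =
    phi (mmap kappa (fun i : 'I_n => (-1) ^+ i.+1 * p`_(n - i.+1)) T).
Proof.
move=> symP; exists (symf P) => S L kappa phi theta p pE.
set c := (fun i : 'I_n => _).
pose u : {mpoly k[n]} -> L := mmap (phi \o kappa) theta.
pose v : {mpoly k[n]} -> L := phi \o mmap kappa c.
rewrite [in LHS](symfP symP).
pose w : {mpoly k[n]} -> L := u \o comp_mpoly [tuple (mesym n k i.+1) | i < n].
rewrite -[LHS]/(w (symf P)) -[RHS]/(v (symf P)).
apply: mpoly_morph_eq => [a|i]; rewrite /w /v /u /=.
  by rewrite comp_mpolyC !mmapC.
rewrite comp_mpolyXU mmapX mmap1U -tnth_nth tnth_mktuple /c.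
have -> : mmap (phi \o kappa) theta (mesym n k i.+1) = (mesym n L i.+1).@[theta].
  rewrite /mesym !raddf_sum /=; apply/eq_bigr => h _.
  rewrite !rmorph_prod /=; apply/eq_bigr=> j _.
  by rewrite mmapX mmap1U mevalXU.
have ltin : (i.+1 < n.+1)%N by rewrite ltnS.
have := mroots_coeff [tuple theta j | j < n] (Ordinal ltin).
rewrite big_tuple /=.
have -> : \prod_(j < n) ('X - (tnth [tuple theta j | j < n] j)%:P) = map_poly phi p.
  by rewrite pE; apply: eq_bigr => j _; rewrite tnth_mktuple.
rewrite coef_map rmorphM /= => ->.
rewrite rmorphXn rmorphN1 mulrA -exprMn mulN1r opprK expr1n mul1r.
by apply: meval_eq => j; rewrite tnth_mktuple.
Qed.

Section SymmetricFunctions.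
Variables (F L : fieldType) (phi : {rmorphism F -> L}) (n : nat).
Variables (theta : 'I_n -> L) (p : {poly F}).
Hypothesis pE : map_poly phi p = \prod_(i < n) ('X - (theta i)%:P).

Let symm (P : {mpoly F[n]}) : P \is symmetric ->
  exists a, mmap phi theta P = phi a.
Proof.
move=> /symmetric_eval[T TP]; have := TP F L idfun phi theta p pE.
by eexists; first exact: H.
Qed.

(** The polynomial g in the i-th of n variables. *)
Let gX (g : {poly F}) i := (map_poly (@mpolyC n F) g).['X_i].

Let msym_gX (s : {perm 'I_n}) g i : msym s (gX g i) = gX g (s i).
Proof.
rewrite /gX -horner_map -map_poly_comp /=.
have -> : msym s 'X_i = 'X_(s i) :> {mpoly F[n]} by rewrite /msym mmapX mmap1U.
by congr (_.[_]); apply: eq_map_poly => c /=; rewrite /msym mmapC.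
Qed.

Let mmap_gX g i : mmap phi theta (gX g i) = (map_poly phi g).[theta i].
Proof.
rewrite /gX -horner_map -map_poly_comp /= mmapX mmap1U.
by congr (_.[_]); apply: eq_map_poly => c /=; rewrite mmapC.
Qed.

(** With theta the conjugates of an element of degree n, this product is the norm
and the next sum the trace of the element represented by g. *)
Lemma norm_descent (g : {poly F}) :
  exists a, \prod_(i < n) (map_poly phi g).[theta i] = phi a.
Proof.
have [|a aE] := symm (P := \prod_i gX g i); last first.
  by exists a; rewrite -aE rmorph_prod; apply: eq_bigr => i _; rewrite /= mmap_gX.
apply/issymP=> s; rewrite rmorph_prod /=.
rewrite [RHS](reindex_inj (@perm_inj _ s)); apply: eq_bigr => i _.
exact: msym_gX.
Qed.

Lemma trace_descent (g : {poly F}) :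
  exists a, \sum_(i < n) (map_poly phi g).[theta i] = phi a.
Proof.
have [|a aE] := symm (P := \sum_i gX g i); last first.
  by exists a; rewrite -aE rmorph_sum; apply: eq_bigr => i _; rewrite /= mmap_gX.
apply/issymP=> s; rewrite rmorph_sum /=.
rewrite [RHS](reindex_inj (@perm_inj _ s)); apply: eq_bigr => i _.
exact: msym_gX.
Qed.
End SymmetricFunctions.

(** * Norms and traces of logarithmic derivatives *)

Section NormTransfer.
Variables (F : fieldType) (E : closedFieldType) (phi : {rmorphism F -> E}).
Hypotheses (F0 : [pchar F] =i pred0) (algE : forall y, algebraicOver phi y).

Local Notation ev y g := (map_poly phi g).[y].

Lemma primitive_seq (s : seq E) :
  exists theta, forall y, y \in s -> exists g, ev theta g = y.
Proof.
elim: s => [|x s [theta IH]]; first by exists 0.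
case: (algE x) (algE theta) => [p pnz px] [q qnz qt].
have [n [[r rE] [t tE]]] := pchar0_PET pnz px qnz qt F0.
exists (theta *+ n - x) => y; rewrite inE => /predU1P[->|/IH[g gE]].
  by exists r.
by exists (g \Po t); rewrite map_comp_poly horner_comp tE.
Qed.

Variables (delta : E -> E) (dF : F -> F).
Hypotheses (derd : is_deriv idfun delta) (deltaF : forall a, delta (phi a) = phi (dF a)).

Let deriv_ev y g : delta (ev y g) = ev y (map_poly dF g) + ev y g^`() * delta y.
Proof.
have dF0 : dF 0 = 0.
  by apply: (fmorph_inj phi); rewrite -deltaF !rmorph0 (derivation0 derd).
rewrite (derivation_horner phi derd) /=; congr (_.[_] + _).
by apply/polyP=> i; rewrite !(coef_map_id0, coef_map) ?rmorph0 //= ?deltaF ?dF0 ?rmorph0.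
Qed.

(** Conjugation, without automorphisms: p is the minimal polynomial of theta and
theta' is another root of p. A polynomial relation over F that holds at theta
holds at theta', and so do differential relations, because the derivative of
theta is a polynomial B in theta and that of theta' is then B(theta'). *)
Section Conjugates.
Variables (theta : E) (p B : {poly F}).
Hypotheses (ptheta : root (map_poly phi p) theta)
  (pmin : forall q, root (map_poly phi q) theta -> p %| q)
  (p'theta : ev theta p^`() != 0) (Btheta : ev theta B = delta theta).

Lemma min_coprime q : ev theta q != 0 -> coprimep p q.
Proof.
move=> qt; have /dvdpP[r rE] := dvdp_gcdl p q.
have gt : ~~ root (map_poly phi (gcdp p q)) theta.
  have /dvdpP[s sE] := dvdp_gcdr p q; apply: contraNN qt => gt.
  by rewrite sE rmorphM hornerM (rootP gt) mulr0.
have /pmin pr : root (map_poly phi r) theta.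
  by move: ptheta; rewrite {1}rE rmorphM rootM (negPf gt) orbF.
have pnz : p != 0.
  by apply: contraNneq p'theta => ->; rewrite deriv0 rmorph0 horner0.
have rnz : r != 0 by by apply: contraNneq pnz => r0; rewrite rE r0 mul0r.
have gnz : gcdp p q != 0 by rewrite gcdp_eq0 negb_and pnz.
have := dvdp_leq rnz pr; rewrite {1}rE size_mul //.
rewrite /coprimep; move: gnz; rewrite -size_poly_gt0.
have := rnz; rewrite -size_poly_gt0.
case: (size r) => // m _; case: (size _) => // [[//|j]] _.
by rewrite !addnS addSn /= ltnNge leq_addr.
Qed.

Variable theta' : E.
Hypothesis ptheta' : root (map_poly phi p) theta'.

Lemma conjugate_root h : ev theta h = 0 -> ev theta' h = 0.
Proof.
by move/rootP/pmin/dvdpP=> [q ->]; rewrite rmorphM hornerM (rootP ptheta') mulr0.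
Qed.

Lemma conjugate_neq0 h : ev theta h != 0 -> ev theta' h != 0.
Proof.
move/min_coprime; rewrite -(coprimep_map phi) => /coprimep_root; exact.
Qed.

Let D (g : {poly F}) := map_poly dF g + g^`() * B.

Lemma derive_theta g : delta (ev theta g) = ev theta (D g).
Proof. by rewrite deriv_ev rmorphD rmorphM /= !hornerE Btheta. Qed.

Lemma derive_conjugate g : delta (ev theta' g) = ev theta' (D g).
Proof.
rewrite deriv_ev rmorphD rmorphM /= !hornerE; congr (_ + _ * _).
have e2 : ev theta' (D p) = 0.
  by apply: conjugate_root; rewrite -derive_theta (rootP ptheta) (derivation0 derd).
have := deriv_ev theta' p; rewrite (rootP ptheta') (derivation0 derd) => e1.
apply: (mulfI (conjugate_neq0 p'theta)); apply: (addrI (ev theta' (map_poly dF p))).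
by rewrite -e1; move: e2; rewrite rmorphD rmorphM /= !hornerE => ->.
Qed.
End Conjugates.

(** Write everything as polynomials in a primitive element theta, conjugate the
relations and combine them over all the conjugates of theta: multiplicative
relations pass to the norms [nu i] of the [z i], and the sum of the logarithmic
derivatives of the conjugates of [z i] is the logarithmic derivative of [nu i].
The exponents are split into two families a and b of natural numbers to avoid
inverses of polynomials. *)
Lemma norm_transfer N (z u : 'I_N -> E) (c : 'I_N -> F) (v : E)
    (a b : 'I_N -> nat) (w : F) :
  (forall i, z i != 0) -> (forall i, delta (z i) = z i * u i) ->
  \sum_i phi (c i) * u i = delta v ->
  phi w * \prod_i z i ^+ b i = \prod_i z i ^+ a i ->
  exists n (nu : 'I_N -> F) (tau : F), [/\ (0 < n)%N, forall i, nu i != 0,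
    w ^+ n * \prod_i nu i ^+ b i = \prod_i nu i ^+ a i
  & \sum_i phi (c i) * (delta (phi (nu i)) / phi (nu i)) = delta (phi tau)].
Proof.
move=> znz zu cu wz.
have [theta inF] := primitive_seq (v :: codom z ++ codom u).
have [|V VE] := inF v; first by rewrite mem_head.
have /choice[G GE] i : exists g, ev theta g = z i.
  by apply: inF; rewrite inE mem_cat codom_f orbT.
have /choice[U UE] i : exists g, ev theta g = u i.
  by apply: inF; rewrite inE mem_cat codom_f !orbT.
have [p [pmonic ptheta pmin p'theta]] := minimal_polyP F0 (algE theta).
have [B BE] : exists B, ev theta B = delta theta.
  have /Bezout_eq1_coprimepP[[s t] /= stE] := min_coprime ptheta pmin p'theta p'theta.
  (* As s p + t p' = 1, the inverse of p'(theta) is t(theta). *)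
  exists (- (map_poly dF p * t)).
  have /(congr1 (fun q => ev theta q)) := stE.
  rewrite rmorphD !rmorphM rmorph1 !hornerE (rootP ptheta) mulr0 add0r => tE.
  have := deriv_ev theta p; rewrite (rootP ptheta) (derivation0 derd) => /esym/eqP.
  rewrite addr_eq0 => /eqP dE.
  rewrite rmorphN rmorphM /= !hornerE dE mulNr opprK mulrAC.
  by rewrite [_ * _.[theta]]mulrC tE mul1r.
have [r rE] := closed_field_poly_normal (map_poly phi p).
have {rE} rE : map_poly phi p = \prod_(j < size r) ('X - (r`_j)%:P).
  rewrite rE lead_coef_map (monicP pmonic) rmorph1 scale1r.
  by rewrite (big_nth 0) big_mkord.
set n := size r in rE.
have rootr (j : 'I_n) : root (map_poly phi p) r`_j.
  rewrite rE (bigD1 j) //= rootM; apply/orP; left.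
  by rewrite root_XsubC.
have /choice[nu nuE] i := norm_descent rE (G i).
have [tau tauE] := trace_descent rE V.
have conj0 j := conjugate_root pmin (rootr j).
have dconj (j : 'I_n) g := derive_conjugate ptheta pmin p'theta BE (rootr j) g.
have dtheta g := derive_theta BE g.
have n_gt0 : (0 < n)%N.
  rewrite lt0n; apply/eqP=> n_0; move: ptheta; rewrite rE big1.
    by rewrite rootC oner_eq0.
  by move=> j; case: (j) => m; rewrite n_0.
have Gnz i (j : 'I_n) : ev r`_j (G i) != 0.
  by apply: (conjugate_neq0 ptheta pmin p'theta (rootr j)); rewrite GE.
have dG i (j : 'I_n) : delta (ev r`_j (G i)) = ev r`_j (G i) * ev r`_j (U i).
  have := conj0 j ((map_poly dF (G i) + (G i)^`() * B) - G i * U i).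
  rewrite !(rmorphB, rmorphM) !hornerE -dtheta GE UE zu subrr => /(_ erefl)/eqP.
  by rewrite subr_eq0 => /eqP <-; rewrite dconj.
exists n, nu, tau; split=> //.
- by move=> i; rewrite -(inj_eq (fmorph_inj phi)) -nuE rmorph0; apply/prodf_neq0.
- apply: (fmorph_inj phi); rewrite rmorphM !rmorph_prod rmorphXn /=.
  under eq_bigr do rewrite rmorphXn /= -nuE -prodrXl.
  under [RHS]eq_bigr do rewrite rmorphXn /= -nuE -prodrXl.
  rewrite exchange_big [RHS]exchange_big /= -[n in _ ^+ n]card_ord -prodr_const.
  rewrite -big_split; apply: eq_bigr => j _ /=.
  have := conj0 j (w%:P * \prod_i G i ^+ b i - \prod_i G i ^+ a i).
  rewrite rmorphB rmorphM /= !rmorph_prod map_polyC !hornerE !horner_prod /=.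
  have evX y (m : 'I_N -> nat) : \prod_i (map_poly phi (G i ^+ m i)).[y]
      = \prod_i (map_poly phi (G i)).[y] ^+ m i.
    by apply: eq_bigr => i _; rewrite rmorphXn hornerE.
  rewrite !evX; under eq_bigr do rewrite GE.
  under [X in _ - X]eq_bigr do rewrite GE.
  by rewrite wz subrr => /(_ erefl)/eqP; rewrite subr_eq0 => /eqP.
rewrite -tauE (derivation_sum derd).
have dnu i : delta (phi (nu i)) / phi (nu i) = \sum_(j < n) ev r`_j (U i).
  have nunz : phi (nu i) != 0 by rewrite -nuE; apply/prodf_neq0.
  have := @logderiv_prod _ _ idfun _ derd _ (index_enum _) (fun j : 'I_n => ev r`_j (G i))
    (fun j : 'I_n => ev r`_j (U i)) (dG i).
  by rewrite /= nuE => ->; rewrite mulrC mulKf.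
under eq_bigr do rewrite dnu mulr_sumr.
rewrite exchange_big; apply: eq_bigr => j _ /=.
have sE y : (map_poly phi (\sum_i (c i)%:P * U i)).[y] = \sum_i phi (c i) * ev y (U i).
  rewrite rmorph_sum horner_sum; apply: eq_bigr => i _.
  by rewrite /= rmorphM /= map_polyC !hornerE.
pose h := \sum_i (c i)%:P * U i - (map_poly dF V + V^`() * B).
have hE y : ev y h = \sum_i phi (c i) * ev y (U i)
    - ev y (map_poly dF V + V^`() * B).
  by rewrite rmorphB hornerD hornerN sE.
have : ev theta h = 0.
  rewrite hE -dtheta VE -cu; apply/eqP; rewrite subr_eq0; apply/eqP.
  by apply: eq_bigr => i _; rewrite UE.
by move/conj0 => /(_ j)/eqP; rewrite hE -dconj subr_eq0 => /eqP.
Qed.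
End NormTransfer.

(** * Orders and residues at w = 0

For a derivation delta with delta w = 1 which kills k, the element w is
transcendental over k and delta is d/dw on k(w). Elements of k(w) are fractions
f(w) / g(w) with f and g in k[X]. *)

Section SimplePole.
Variables (k E : fieldType) (kappa : {rmorphism k -> E}) (delta : E -> E) (w : E).
Hypotheses (k0 : [pchar k] =i pred0) (derd : is_deriv idfun delta).
Hypotheses (deltak : forall c, delta (kappa c) = 0) (deltaw : delta w = 1).

Definition point_eval : {poly k} -> E := horner_eval w \o map_poly kappa.
HB.instance Definition _ := GRing.RMorphism.on point_eval.
Local Notation ev := point_eval.

Lemma derive_point_eval p : delta (ev p) = ev p^`().
Proof.
rewrite /ev /= (derivation_horner kappa derd) deltaw mulr1.
have -> : map_poly (delta \o kappa) p = 0.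
  by apply/polyP=> i; rewrite coef0 coef_map_id0 //= -(rmorph0 kappa).
by rewrite horner0 add0r.
Qed.

(** At w, the minimal polynomial and hence its derivative would vanish. *)
Lemma transcendental_point : ~ algebraicOver kappa w.
Proof.
move/(minimal_polyP k0)=> [p [_ pw _]]; have := derive_point_eval p.
by rewrite /ev /= !horner_evalE (rootP pw) (derivation0 derd) => <-; rewrite eqxx.
Qed.

Lemma point_eval_inj : injective ev.
Proof.
apply: raddf_inj => p pw; apply/eqP; apply: contrapT => /negP pnz.
by apply: transcendental_point; exists p => //; apply/rootP.
Qed.

Let ev_eq0 p : (ev p == 0) = (p == 0).
Proof. by rewrite -[RHS](inj_eq point_eval_inj) rmorph0. Qed.

Let evC c : ev c%:P = kappa c.
Proof. by rewrite /ev /= map_polyC horner_evalE hornerC. Qed.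

Let evX : ev 'X = w.
Proof. by rewrite /ev /= map_polyX horner_evalE hornerX. Qed.

Let wnz : w != 0.
Proof. by rewrite -evX ev_eq0 polyX_eq0. Qed.

(** The local ring of k(w) at w = 0. *)
Definition regular0 (r : E) := exists f g : {poly k}, g.[0] != 0 /\ r = ev f / ev g.

Let gnz (g : {poly k}) : g.[0] != 0 -> ev g != 0.
Proof. by rewrite ev_eq0; apply: contraNneq => ->; rewrite horner0. Qed.

Lemma regular0D r s : regular0 r -> regular0 s -> regular0 (r + s).
Proof.
move=> [f [g [g0 ->]]] [f1 [g1 [g10 ->]]].
exists (f * g1 + f1 * g), (g * g1); rewrite hornerM mulf_neq0 //; split=> //.
by rewrite addf_div ?gnz // rmorphD !rmorphM.
Qed.

Lemma regular0M r s : regular0 r -> regular0 s -> regular0 (r * s).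
Proof.
move=> [f [g [g0 ->]]] [f1 [g1 [g10 ->]]].
exists (f * f1), (g * g1); rewrite hornerM mulf_neq0 //; split=> //.
by rewrite mulf_div !rmorphM.
Qed.

Lemma regular0_ev f : regular0 (ev f).
Proof. by exists f, 1; rewrite hornerC oner_eq0 rmorph1 divr1. Qed.

Lemma regular0C c : regular0 (kappa c).
Proof. by rewrite -evC; apply: regular0_ev. Qed.

Lemma regular0V f : f.[0] != 0 -> regular0 (ev f)^-1.
Proof. by move=> f0; exists 1, f; rewrite rmorph1 mul1r. Qed.

Lemma regular0X n : regular0 (w ^+ n).
Proof. by rewrite -evX -rmorphXn; apply: regular0_ev. Qed.

Lemma regular0N r : regular0 r -> regular0 (- r).
Proof. by rewrite -mulN1r -(rmorphN1 kappa); apply/regular0M/regular0C. Qed.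

Lemma regular0B r s : regular0 r -> regular0 s -> regular0 (r - s).
Proof. by move=> rr /regular0N; apply: regular0D. Qed.

Lemma regular0_derive r : regular0 r -> regular0 (delta r).
Proof.
move=> [f [g [g0 ->]]]; rewrite (derivation_div derd) ?gnz // !derive_point_eval /=.
apply: regular0M; last by rewrite -rmorphXn; apply/regular0V; rewrite horner_exp expf_neq0.
by apply: regular0B; apply: regular0M; apply: regular0_ev.
Qed.

Lemma regular0_simple_pole c : regular0 (kappa c / w) -> c = 0.
Proof.
move=> [f [g [g0 /eqP]]]; rewrite eqr_div ?gnz // -evC -evX -!rmorphM /=.
rewrite (inj_eq point_eval_inj) => /eqP/(congr1 (horner^~ 0)).
rewrite /= !hornerM hornerC hornerX mulr0 => /eqP.
by rewrite mulf_eq0 (negPf g0) orbF => /eqP.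
Qed.

Let phi := frac_map point_eval_inj.

Definition has_order (y : E) (m : int) := exists f g : {poly k},
  [/\ f.[0] != 0, g.[0] != 0 & y = w ^ m * (ev f / ev g)].

Lemma order_exists x : x != 0 -> exists m, has_order (phi x) m.
Proof.
have [/= b0 ->] := frac_repP x; move: (frac_rep x) b0 => [a b] /= b0 x0.
have a0 : a != 0 by apply: contraNneq x0 => ->; rewrite tofrac0 mul0r.
rewrite /phi frac_mapE //.
have [m [f + ->]] := multiplicity_XsubC a 0; rewrite a0 /= => f0.
have [n [g + ->]] := multiplicity_XsubC b 0; rewrite b0 /= => g0.
exists (m%:Z - n%:Z), f, g; split=> //.
rewrite subr0 !rmorphM !rmorphXn /= evX expfzDr // -exprnN -!exprnP.
by field; rewrite expf_neq0 // andbT; apply: gnz.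
Qed.

Lemma order0 : has_order 1 0.
Proof. by exists 1, 1; rewrite hornerC oner_eq0 rmorph1 divr1 expr0z mulr1. Qed.

Lemma orderM y1 y2 m1 m2 :
  has_order y1 m1 -> has_order y2 m2 -> has_order (y1 * y2) (m1 + m2).
Proof.
move=> [f1 [g1 [f10 g10 ->]]] [f2 [g2 [f20 g20 ->]]].
exists (f1 * f2), (g1 * g2); rewrite !hornerM !mulf_neq0 //; split=> //.
by rewrite expfzDr // !rmorphM -mulf_div mulrACA.
Qed.

Lemma orderX y m n : has_order y m -> has_order (y ^+ n) (m *+ n).
Proof.
move=> ym; elim: n => [|n IH]; first exact: order0.
by rewrite exprS mulrS; apply: orderM.
Qed.

Lemma order_prod (I : Type) (r : seq I) (y : I -> E) (m : I -> int) :
  (forall i, has_order (y i) (m i)) ->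
  has_order (\prod_(i <- r) y i) (\sum_(i <- r) m i).
Proof.
move=> ym; elim: r => [|i r IH]; first by rewrite !big_nil; apply: order0.
by rewrite !big_cons; apply: orderM.
Qed.

Lemma order_var : has_order w 1.
Proof. by exists 1, 1; rewrite hornerC oner_eq0 rmorph1 divr1 mulr1. Qed.

Lemma order_unique y m1 m2 : has_order y m1 -> has_order y m2 -> m1 = m2.
Proof.
wlog : m1 m2 / (m1 <= m2)%R => [wl|le12] y1 y2.
  by case: (leP m1 m2) => [|/ltW] le; [|apply/esym]; apply: wl.
move: y1 y2 => [f1 [g1 [f10 g10 ->]]] [f2 [g2 [f20 g20 /eqP]]].
have [n ->] : exists n : nat, m2 = m1 + n.
  by exists `|m2 - m1|%N; rewrite gez0_abs ?subr_ge0 // [RHS]addrC subrK.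
rewrite expfzDr // -mulrA => /eqP/(mulfI (expfz_neq0 _ wnz))/eqP.
rewrite mulrA eqr_div ?gnz // -exprnP -evX -rmorphXn -!rmorphM /=.
rewrite (inj_eq point_eval_inj) => /eqP/(congr1 (horner^~ 0)).
rewrite !hornerM horner_exp hornerX expr0n; case: n => [|n]; first by rewrite addr0.
by rewrite !mul0r => /eqP; rewrite mulf_eq0 (negPf f10) (negPf g20).
Qed.

Lemma regular0_unit (f g : {poly k}) : f.[0] != 0 -> g.[0] != 0 ->
  regular0 (delta (ev f / ev g) / (ev f / ev g)).
Proof.
move=> f0 g0; rewrite invf_div; apply: regular0M; last by exists g, f.
by apply: regular0_derive; exists f, g.
Qed.

Lemma logderiv_order y m : has_order y m ->
  exists2 r, regular0 r & delta y / y = kappa m%:~R / w + r.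
Proof.
move=> [f [g [f0 g0 ->]]]; set u := ev f / ev g.
exists (delta u / u); first exact: regular0_unit.
have unz : u != 0 by rewrite mulf_neq0 ?invr_eq0 ?gnz.
have wm (n : nat) : delta (w ^ n) / w ^ n = kappa n%:R / w.
  rewrite -exprnP (derivationX derd) /= deltaw mulr1 rmorph_nat.
  case: n => [|n]; first by rewrite !mulr0n !mul0r.
  by rewrite exprS -mulr_natl; field; rewrite wnz expf_neq0.
have {}wm : delta (w ^ m) / w ^ m = kappa m%:~R / w.
  case: m => n; first exact: wm.
  rewrite NegzE -exprnN (derivationV derd) /= invrK mulrNz rmorphN /= !mulNr -pmulrn -wm -exprnP.
  by field; rewrite expf_neq0.
rewrite (derivationM derd) /= -wm; field.
by rewrite unz expfz_neq0.
Qed.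

(** The derivative of an element of order m >= 0 is regular, and that of
an element of order m < 0 has a pole of order 1 - m > 1: a derivative has no
simple pole. *)
Lemma regular0_no_residue c tau :
  regular0 (delta (phi tau) - kappa c / w) -> c = 0.
Proof.
have [->|tau0] := eqVneq tau 0.
  rewrite /phi rmorph0 (derivation0 derd) sub0r => /regular0N.
  by rewrite opprK; apply: regular0_simple_pole.
have [m [f [g [f0 g0 ->]]]] := order_exists tau0; set u := ev f / ev g.
have ureg : regular0 u by exists f, g.
have ureg' := regular0_derive ureg.
case: m => n.
  rewrite -exprnP => creg; apply: regular0_simple_pole.
  have treg : regular0 (delta (w ^+ n * u)).
    by apply/regular0_derive/regular0M => //; apply: regular0X.
  by rewrite -[X in regular0 X](subKr (delta (w ^+ n * u))); apply: regular0B.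
rewrite NegzE -exprnN => creg.
have unz : u != 0 by rewrite mulf_neq0 ?invr_eq0 ?gnz.
have uVreg : regular0 u^-1 by rewrite invf_div; exists g, f.
clearbody u.
(* If tau = w ^ -(n+1) u and its derivative is c / w up to a regular element,
   multiplying by w ^ (n+1) makes (n+1) u / w regular. *)
have : regular0 (kappa n.+1%:R / w).
  rewrite (_ : _ / w = (u)^-1 * (delta u
      - w ^+ n * (w * (delta ((w ^+ n.+1)^-1 * u) - kappa c / w)) - kappa c * w ^+ n)).
    apply: regular0M => //.
    apply: regular0B; last by apply: regular0M; [apply: regular0C|apply: regular0X].
    apply: regular0B => //; apply: regular0M; first exact: regular0X.
    by apply: regular0M => //; rewrite -[w]expr1; apply: regular0X.
  rewrite (derivationM derd) (derivationV derd) (derivationX derd) /= deltaw.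
  rewrite mulr1 rmorph_nat exprS -mulr_natr; field.
  by rewrite wnz unz expf_neq0.
move/regular0_simple_pole/eqP; have /pcharf0P -> // := k0.
Qed.

(** The residue at 0 of the logarithmic derivative of an element is its order,
and that of a derivative is 0. *)
Lemma residue_relation N (c : 'I_N -> k) (nu : 'I_N -> E) (m : 'I_N -> int) tau :
  (forall i, has_order (nu i) (m i)) ->
  \sum_i kappa (c i) * (delta (nu i) / nu i) = delta (phi tau) ->
  \sum_i c i * (m i)%:~R = 0.
Proof.
move=> num /esym dtau.
have /choice[r rP] i : exists r, regular0 r /\
    delta (nu i) / nu i = kappa (m i)%:~R / w + r.
  by have [r rr e] := logderiv_order (num i); exists r.
apply: (@regular0_no_residue _ tau); rewrite dtau rmorph_sum mulr_suml -sumrB.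
apply: (big_ind regular0); first by rewrite -(rmorph0 kappa); apply: regular0C.
  exact: regular0D.
move=> i _; have [rr ->] := rP i.
rewrite rmorphM mulrDr mulrA addrC addKr.
by apply: regular0M => //; apply: regular0C.
Qed.
End SimplePole.

(** * Subfields as types *)

Section Subfields.
Variables (L : fieldType) (S : divringClosed L).

Record subfield := Subfield { subfield_val :> L; subfield_valP : subfield_val \in S }.

HB.instance Definition _ := [isSub for subfield_val].
HB.instance Definition _ := [Choice of subfield by <:].
HB.instance Definition _ := [SubChoice_isSubIntegralDomain of subfield by <:].
HB.instance Definition _ := [SubIntegralDomain_isSubField of subfield by <:].
HB.instance Definition _ := GRing.RMorphism.copy subfield_val (val : subfield -> L).
End Subfields.

Section AlgebraicClosure.
Variables (F L : fieldType) (phi : {rmorphism F -> L}).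

Definition alg_closure : {pred L} := fun y => `[< algebraicOver phi y >].

Fact alg_closure_divring : divring_closed alg_closure.
Proof.
split=> [|x y /asboolP ax /asboolP ay|x y /asboolP ax /asboolP ay]; apply/asboolP.
- exact: algebraic1.
- exact: algebraic_sub.
- exact: algebraic_div.
Qed.

HB.instance Definition _ := GRing.isDivringClosed.Build L alg_closure alg_closure_divring.
End AlgebraicClosure.

Section Constants.
Variables (E L : fieldType) (iota : {rmorphism E -> L}) (D : E -> L).
Hypothesis derD : is_deriv iota D.

(** The proof that D is a derivation is an argument so that this predicate can
be declared as a subfield. *)
Definition constants of is_deriv iota D : {pred E} := fun y => D y == 0.

Fact constants_divring : divring_closed (constants derD).
Proof.
split=> [|x y /eqP dx /eqP dy|x y /eqP dx /eqP dy]; apply/eqP.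
- exact: derivation1 derD.
- by rewrite (derivationB derD) dx dy subr0.
- by rewrite (derivationM derD) (derivationV derD) dx dy !(mul0r, mulr0, oppr0, addr0).
Qed.

HB.instance Definition _ := GRing.isDivringClosed.Build E (constants derD) constants_divring.
End Constants.

(** * The residue theorem *)

Lemma clear_denominators (S : idomainType) (p : {poly {fraction S}}) :
  exists2 d : S, d != 0 & exists q : {poly S}, map_poly (@tofrac S) q = tofrac d *: p.
Proof.
elim/poly_ind: p => [|p c [d d0 [q qE]]].
  by exists 1; [exact: oner_neq0|exists 0; rewrite map_poly0 scaler0].
have [/= b0] := frac_repP c; move: (frac_rep c) b0 => [a b] /= b0 cE.
have aE : tofrac a = tofrac b * c by rewrite cE mulrC divfK ?tofrac_eq0.
exists (d * b); first by rewrite mulf_neq0.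
exists (b *: q * 'X + (d * a)%:P).
rewrite rmorphD !rmorphM /= map_polyX !map_polyC map_polyZ qE /= aE.
by rewrite -!mul_polyC !polyCM; ring.
Qed.

Section Exchange.
Variables (k E : fieldType) (kappa : {rmorphism k -> E}) (x w : E).
Hypotheses (x_inj : injective (point_eval kappa x))
  (w_inj : injective (point_eval kappa w)).

(** Read the relation between x and w, a polynomial in w with coefficients in
k[x], as a polynomial in x with coefficients in k[w]; it is not zero as w is
transcendental over k. *)
Lemma algebraic_exchange :
  algebraicOver (frac_map x_inj) w -> algebraicOver (frac_map w_inj) x.
Proof.
case=> p pnz pw; have [d d0 [q qE]] := clear_denominators p.
have qnz : q != 0.
  apply: contraNneq pnz => q0; move/eqP: qE; rewrite q0 map_poly0 eq_sym scaler_eq0.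
  by rewrite tofrac_eq0 (negPf d0).
have evE y (y_inj : injective (point_eval kappa y)) (r : {poly {poly k}}) :
    map_poly (frac_map y_inj) (map_poly (@tofrac _) r) =
    map_poly (horner_eval y) (map_poly (map_poly kappa) r).
  rewrite -!map_poly_comp; apply: eq_map_poly => c /=.
  by rewrite frac_map_tofrac.
exists (map_poly (@tofrac _) (swapXY q)).
  have tinj : injective (@tofrac {poly k}) by move=> a b /eqP; rewrite tofrac_eq => /eqP.
  rewrite -(map_poly0 (@tofrac {poly k})) (inj_eq (map_inj_poly tinj (tofrac0 _))).
  by rewrite swapXY_eq0.
rewrite evE -swapXY_map -horner_swapXY swapXYK /root.
rewrite -horner2_swapXY horner_swapXY -evE qE map_polyZ hornerZ (rootP pw).
by rewrite mulr0.
Qed.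
End Exchange.

Section ResidueTheorem.
Variables (E : closedFieldType) (delta : E -> E) (x : E).
Hypotheses (E0 : [pchar E] =i pred0) (derd : is_deriv idfun delta) (dx : delta x != 0).

(** This says that E is algebraic over the field generated by x and the
constants of delta, without mentioning that field. *)
Hypothesis algE : forall (G : fieldType) (phi : {rmorphism G -> E}),
  (forall c, delta c = 0 -> algebraicOver phi c) -> algebraicOver phi x ->
  forall y, algebraicOver phi y.

(** The kernel of delta is first an abstract field k, then the actual subfield.
All the derivations used are delta / t for t in E, which have the same kernel. *)
Section ConstantField.
Variables (k : fieldType) (kappa : {rmorphism k -> E}).
Hypotheses (deltak : forall c, delta (kappa c) = 0)
  (constk : forall c, delta c = 0 -> exists a, c = kappa a).

Let k0 : [pchar k] =i pred0.
Proof. by move=> p; rewrite -(fmorph_pchar kappa) E0. Qed.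

Let scale_der t : is_deriv idfun (fun y => delta y / t).
Proof.
by split=> a b; rewrite ?(derivationD derd) ?(derivationM derd) mulrDl // !mulrA.
Qed.

Let scalek t c : delta (kappa c) / t = 0.
Proof. by rewrite deltak mul0r. Qed.

Let alg_over_var y (y_inj : injective (point_eval kappa y)) :
  algebraicOver (frac_map y_inj) x -> forall z, algebraicOver (frac_map y_inj) z.
Proof.
move=> ax; apply: algE ax => _ /constk[c ->].
have -> : kappa c = frac_map y_inj (tofrac c%:P).
  by rewrite frac_map_tofrac /= /point_eval /= map_polyC horner_evalE hornerC.
exact: algebraic_id.
Qed.

Let frac_var y (y_inj : injective (point_eval kappa y)) : frac_map y_inj (tofrac 'X) = y.
Proof.
by rewrite frac_map_tofrac /= /point_eval /= map_polyX horner_evalE hornerX.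
Qed.

(** As delta w <> 0, w is transcendental over k, and by exchange E is algebraic
over k(w). Normalize delta by delta w = 1, take norms and traces down to k(w),
and then orders at w = 0: the integers [m i] are the orders of the norms of the
[z i], and w ^ n, the norm of w, has order n > 0. *)
Lemma residue_theorem_over N (z u c : 'I_N -> E) (v : E) (a b : 'I_N -> nat) (w : E) :
  (forall i, z i != 0) -> (forall i, delta (z i) = z i * u i) ->
  (forall i, delta (c i) = 0) -> \sum_i c i * u i = delta v ->
  w * \prod_i z i ^+ b i = \prod_i z i ^+ a i -> delta w != 0 ->
  exists m : 'I_N -> int, \sum_i c i * (m i)%:~R = 0 /\
    \sum_i m i *+ a i != \sum_i m i *+ b i.
Proof.
move=> znz zu c0 cu wz dw.
have xinj := point_eval_inj k0 (scale_der (delta x)) (scalek _) (divff dx).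
have aw : algebraicOver (frac_map xinj) w.
  by apply: alg_over_var; rewrite -[X in algebraicOver _ X](frac_var xinj); apply: algebraic_id.
pose d y := delta y / delta w.
have derdw : is_deriv idfun d by exact: scale_der.
have dw1 : d w = 1 by rewrite /d divff.
have ev_inj := point_eval_inj k0 derdw (scalek _) dw1.
pose phi : {rmorphism {fraction {poly k}} -> E} := frac_map ev_inj.
have algphi : forall y, algebraicOver phi y.
  exact: alg_over_var (algebraic_exchange ev_inj aw).
have devw p : d (point_eval kappa w p) = point_eval kappa w p^`().
  exact: (derive_point_eval derdw (scalek _) dw1).
have /choice[dF dFP] s : exists t, d (phi s) = phi t.
  have [/= q0 ->] := frac_repP s; move: (frac_rep s) q0 => [p q] /= q0.
  exists ((tofrac p^`() * tofrac q - tofrac p * tofrac q^`()) / tofrac q ^+ 2).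
  rewrite !(fmorph_div, rmorphB, rmorphM, rmorphXn) /phi /= !frac_map_tofrac.
  rewrite (derivation_div derdw) ?devw //.
  by rewrite -(rmorph0 (point_eval kappa w)) (inj_eq ev_inj).
have G0 : [pchar {fraction {poly k}}] =i pred0.
  by move=> p; rewrite -(fmorph_pchar phi) E0.
have /choice[c' c'E] i := constk (c0 i).
pose C i : {fraction {poly k}} := tofrac (c' i)%:P.
have CE i : phi (C i) = c i.
  by rewrite c'E /phi /= frac_map_tofrac /= /point_eval /= map_polyC horner_evalE hornerC.
have dzu i : d (z i) = z i * (u i / delta w) by rewrite /d zu mulrA.
have csum : \sum_i phi (C i) * (u i / delta w) = d v.
  by rewrite /d -cu mulr_suml; apply: eq_bigr => i _; rewrite CE mulrA.
have Xw : phi (tofrac 'X) * \prod_i z i ^+ b i = \prod_i z i ^+ a i.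
  by rewrite /phi /= frac_var.
have [n [nu [tau [n0 nunz nuw nusum]]]] :=
  norm_transfer G0 algphi derdw dFP znz dzu csum Xw.
have /choice[m mP] i : exists m, has_order kappa w (phi (nu i)) m.
  exact: (order_exists k0 derdw (scalek _) dw1 (nunz i)).
exists m; split.
  have nusum' : \sum_i kappa (c' i) * (d (phi (nu i)) / phi (nu i)) = d (phi tau).
    by rewrite -nusum; apply: eq_bigr => i _; rewrite CE c'E.
  have /(congr1 kappa) := residue_relation (k0 := k0) (derd := derdw) (deltak := scalek _)
    (deltaw := dw1) (nu := phi \o nu) (c := c') mP nusum'.
  rewrite rmorph0 rmorph_sum /= => rel; rewrite -[RHS]rel; apply: eq_bigr => i _.
  by rewrite rmorphM rmorph_int c'E.
have := congr1 phi nuw; rewrite rmorphM rmorphXn !rmorph_prod /phi /= frac_var => nuw'.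
have ordnu (e : 'I_N -> nat) :
    has_order kappa w (\prod_i phi (nu i ^+ e i)) (\sum_i m i *+ e i).
  apply: (order_prod k0 derdw (scalek _) dw1) => i; rewrite rmorphXn.
  exact: (orderX k0 derdw (scalek _) dw1).
have := orderM k0 derdw (scalek _) dw1
  (orderX k0 derdw (scalek _) dw1 n (order_var kappa w)) (ordnu b).
rewrite nuw' => /(order_unique k0 derdw (scalek _) dw1 (ordnu a)) ->.
by rewrite -subr_eq0 addrK mulrn_eq0 negb_or -lt0n n0 oner_eq0.
Qed.
End ConstantField.

Lemma residue_theorem N (z u c : 'I_N -> E) (v : E) (a b : 'I_N -> nat) (w : E) :
  (forall i, z i != 0) -> (forall i, delta (z i) = z i * u i) ->
  (forall i, delta (c i) = 0) -> \sum_i c i * u i = delta v ->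
  w * \prod_i z i ^+ b i = \prod_i z i ^+ a i -> delta w != 0 ->
  exists m : 'I_N -> int, \sum_i c i * (m i)%:~R = 0 /\
    \sum_i m i *+ a i != \sum_i m i *+ b i.
Proof.
have dk (a0 : subfield (constants derd)) : delta (subfield_val a0) = 0.
  by apply/eqP; apply: (subfield_valP a0).
apply: (residue_theorem_over (kappa := @subfield_val _ _) dk) => a0 /eqP da0.
by exists (Subfield (da0 : a0 \in constants derd)).
Qed.
End ResidueTheorem.

(** * Integral relations *)

Lemma pchar0_intr_eq0 (E : fieldType) (m : int) :
  [pchar E] =i pred0 -> (m%:~R == 0 :> E) = (m == 0).
Proof.
move=> /pcharf0P E0; case: m => n; first by rewrite -pmulrn E0.
by rewrite NegzE mulrNz oppr_eq0 -pmulrn E0.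
Qed.

Lemma common_denominator n (q : 'I_n -> rat) :
  exists2 D : int, D != 0 & exists z : 'I_n -> int, forall i, D%:~R * q i = (z i)%:~R.
Proof.
exists (\prod_i denq (q i)); first by apply/prodf_neq0 => i _; rewrite denq_neq0.
exists (fun i => (\prod_(j | j != i) denq (q j)) * numq (q i)) => i.
have e : (denq (q i))%:~R * q i = (numq (q i))%:~R.
  have /(congr1 ( *%R^~ (denq (q i))%:~R)) := divq_num_den (q i).
  by rewrite /= divfK ?intr_eq0 ?denq_neq0 // mulrC => ->.
by rewrite (bigD1 i) //= !rmorphM /= -e; ring.
Qed.

(** The relations span a subspace of Q^N which is not the whole space, since c is
not zero. A matrix of integral relations of maximal rank spans this subspace,
and a nonzero vector of its kernel, cleared of denominators, will do. *)
Lemma relations_orthogonal (E : fieldType) N (c : 'I_N -> E) i0 :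
  [pchar E] =i pred0 -> c i0 != 0 ->
  exists m : 'I_N -> int, (exists i, m i != 0) /\
    forall q : 'I_N -> int, \sum_i c i * (q i)%:~R = 0 -> \sum_i q i * m i = 0.
Proof.
move=> E0 ci0.
pose rel (q : 'I_N -> int) := \sum_i c i * (q i)%:~R = 0.
pose Q r (M : 'M[int]_(r, N)) : 'M[rat]_(r, N) := map_mx intr M.
pose P n := `[< exists r (M : 'M[int]_(r, N)),
  (forall i, rel (M i)) /\ \rank (Q r M) = n >].
have exP : exists n, P n.
  exists 0%N; apply/asboolP; exists 0%N, 0; split; first by case.
  by apply/eqP; rewrite mxrank_eq0; apply/eqP/matrixP; case.
have leP n : P n -> (n <= N)%N by move=> /asboolP[r [M [_ <-]]]; apply: rank_leq_col.
case: (ex_maxnP exP leP) => n /asboolP[r [M [relM rankM]]] nmax.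
have maxM q : rel q -> ((\row_i (q i)%:~R : 'rV[rat]_N) <= Q r M)%MS.
  move=> relq; pose M' : 'M[int]_(r + 1, N) := col_mx M (\row_i q i).
  have /nmax : P (\rank (Q _ M')).
    apply/asboolP; exists (r + 1)%N, M'; split=> // i.
    rewrite -(splitK i); case: split => j /=; rewrite /rel.
      by under eq_bigr do rewrite col_mxEu; apply: relM.
    by under eq_bigr do rewrite col_mxEd mxE.
  have QE : Q _ M' = col_mx (Q r M) (\row_i (q i)%:~R).
    by rewrite /Q map_col_mx; congr col_mx; apply/rowP=> i; rewrite !mxE.
  rewrite -rankM QE => le.
  have sub : (Q r M <= col_mx (Q r M) (\row_i (q i)%:~R))%MS.
    by have := submx_refl (col_mx (Q r M) (\row_i (q i)%:~R)); rewrite col_mx_sub => /andP[].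
  have := mxrank_leqif_sup sub => -[le' /esym]; rewrite eqn_leq le le' /=.
  by rewrite col_mx_sub => /andP[].
have ltN : (n < N)%N.
  rewrite ltn_neqAle -{2}rankM rank_leq_col andbT; apply/negP=> /eqP nN.
  have full : row_full (Q r M) by rewrite /row_full rankM nN.
  have /submxP[X XE] := submx_full (delta_mx 0 i0 : 'rV[rat]_N) full.
  have [D D0 [z zE]] := common_denominator (X 0).
  suff : c i0 * D%:~R = 0.
    by move/eqP; rewrite mulf_eq0 (negPf ci0) /= pchar0_intr_eq0 // (negPf D0).
  have DE i : \sum_j z j * M j i = D *+ (i == i0).
    apply: (@intr_inj rat); rewrite rmorph_sum /=.
    have := congr1 (fun A : 'rV[rat]_N => D%:~R * A 0 i) XE; rewrite !mxE mulr_sumr eqxx /=.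
    rewrite rmorphMn /= mulr_natr eq_sym => ->; apply: eq_bigr => j _.
    by rewrite rmorphM /= -zE mxE mulrA.
  transitivity (\sum_i c i * (\sum_j z j * M j i)%:~R).
    rewrite (bigD1 i0) //= [X in _ + X]big1; last first.
      by move=> i /negPf ii0; rewrite DE ii0 mulr0n mulr0.
    by rewrite addr0 DE eqxx mulr1n.
  under eq_bigr do rewrite rmorph_sum mulr_sumr.
  rewrite exchange_big big1 //= => j _.
  under eq_bigr do rewrite rmorphM mulrCA.
  by rewrite -mulr_sumr relM mulr0.
have : cokermx (Q r M) != 0.
  by rewrite -mxrank_eq0 mxrank_coker rankM subn_eq0 -ltnNge.
case/matrix0Pn => i1 [j mu0].
have [D D0 [m mE]] := common_denominator (fun i => cokermx (Q r M) i j).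
have Dr0 : (D%:~R : rat) != 0 by rewrite intr_eq0.
exists m; split=> [|q /maxM].
  by exists i1; rewrite -(intr_eq0 rat) -mE mulf_neq0.
rewrite submxE => /eqP/matrixP/(_ 0 j); rewrite !mxE => qm.
apply: (@intr_inj rat); rewrite rmorph_sum -[RHS](mulr0 D%:~R) -[in RHS]qm mulr_sumr.
by apply: eq_bigr => i _; rewrite rmorphM /= -mE mxE mulrCA.
Qed.

(** * Linear independence of dy - dz / z *)

Section AbstractAx.
Variables (C : fieldType) (E : closedFieldType) (L : fieldType).
Variables (kappa : {rmorphism C -> E}) (iota : {rmorphism E -> L}).
Hypothesis E0 : [pchar E] =i pred0.
Variables (d : nat) (x : 'I_d -> E) (del : 'I_d -> E -> E).
Hypotheses (der_del : forall j, is_deriv idfun (del j))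
  (delC : forall j c, del j (kappa c) = 0)
  (delx : forall i j, del i (x j) = (i == j)%:R).

(** In the same way, E is algebraic over C(x_1, ..., x_d). *)
Hypothesis algE : forall (G : fieldType) (phi : {rmorphism G -> E}),
  (forall c, algebraicOver phi (kappa c)) -> (forall j, algebraicOver phi (x j)) ->
  forall y, algebraicOver phi y.

(** The kernel of D is a field containing C and the [x j], so E is algebraic over
it and the zero derivation is the only one that vanishes on it. *)
Lemma derivation_eq0 (M : fieldType) (mu : {rmorphism E -> M}) (D : E -> M) :
  is_deriv mu D -> (forall c, D (kappa c) = 0) -> (forall j, D (x j) = 0) ->
  forall y, D y = 0.
Proof.
move=> derD DC Dx y; pose k := constants derD.
pose val_k : {rmorphism subfield k -> E} := @subfield_val _ k.
have ksub a : D a = 0 -> algebraicOver val_k a.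
  move=> /eqP Da; have ka : a \in k by [].
  rewrite (_ : a = val_k (Subfield ka)); [exact: algebraic_id|by []].
have k0 : [pchar subfield k] =i pred0.
  by move=> p; rewrite -(fmorph_pchar val_k) E0.
have der0 : is_deriv mu (fun=> 0) by split=> *; rewrite ?mulr0 ?addr0.
apply: (derivation_unique k0 derD der0 (phi := val_k)).
  by move=> c; apply/eqP; exact: (subfield_valP c).
by apply: algE => *; apply: ksub; rewrite ?DC ?Dx.
Qed.

Lemma derivation_expand (M : fieldType) (mu : {rmorphism E -> M}) (D : E -> M) :
  is_deriv mu D -> (forall c, D (kappa c) = 0) ->
  forall y, D y = \sum_j mu (del j y) * D (x j).
Proof.
move=> derD DC y; apply/eqP; rewrite -subr_eq0; apply/eqP.
pose D' y := D y - \sum_j mu (del j y) * D (x j); rewrite -/(D' y).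
apply: (@derivation_eq0 _ mu); rewrite /D'.
- split=> a b.
    rewrite (derivationD derD); under eq_bigr do rewrite (derivationD (der_del _)) rmorphD mulrDl.
    by rewrite big_split /=; ring.
  rewrite (derivationM derD).
  under eq_bigr do rewrite (derivationM (der_del _)) rmorphD !rmorphM /= mulrDl -!mulrA.
  by rewrite big_split /= -!mulr_sumr; ring.
- move=> c; rewrite DC big1 ?subrr // => j _.
  by rewrite delC rmorph0 mul0r.
move=> i; rewrite (bigD1 i) //= big1 ?addr0 => [|j /negPf ji].
  by rewrite delx eqxx rmorph1 mul1r subrr.
by rewrite delx ji rmorph0 mul0r.
Qed.

(** The commutator is a derivation, and it kills the coordinates. *)
Lemma del_comm i j y : del i (del j y) = del j (del i y).
Proof.
apply/eqP; rewrite -subr_eq0; apply/eqP.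
apply: (@derivation_eq0 _ idfun (fun y => del i (del j y) - del j (del i y))).
- split=> a b.
    by rewrite !(derivationD (der_del _)); ring.
  by rewrite !(derivationM (der_del _), derivationD (der_del _)) /=; ring.
- by move=> c; rewrite !delC !(derivation0 (der_del _)) subrr.
by move=> m; rewrite !delx !(derivation_nat (der_del _)) subrr.
Qed.

Variables (l : nat) (D : 'I_l -> E -> L).
Hypotheses (der_D : forall s, is_deriv iota (D s))
  (DC : forall s c, D s (kappa c) = 0)
  (constE : forall y, (forall s, D s y = 0) -> exists c, y = kappa c).
Variables (N : nat) (y z : 'I_N -> E).
Hypotheses (znz : forall i, z i != 0)
  (Dz : forall s i, D s (z i) = iota (z i) * D s (y i))
  (yfree : forall (q : 'I_N -> int) c, \sum_i y i *~ q i = kappa c -> forall i, q i = 0).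

(** The forms dy_i - dz_i / z_i, in the basis of the dx_j. *)
Let W : 'M[E]_(N, d) := \matrix_(i, j) (del j (y i) - del j (z i) / z i).
Let T : 'M[L]_(d, l) := \matrix_(j, s) D s (x j).

Let WT : map_mx iota W *m T = 0.
Proof.
apply/matrixP=> i s; rewrite !mxE.
have iznz : iota (z i) != 0 by rewrite fmorph_eq0.
transitivity (D s (y i) - D s (z i) / iota (z i)); last by rewrite Dz mulrC mulKf ?subrr.
rewrite (derivation_expand (der_D s) (DC s) (y i)).
rewrite (derivation_expand (der_D s) (DC s) (z i)).
rewrite mulr_suml -sumrB; apply: eq_bigr => j _; rewrite !mxE.
by rewrite rmorphB fmorph_div /=; ring.
Qed.

(** The forms are closed, being sums of an exact and a logarithmic form. *)
Let W_closed i j k : del k (W i j) = del j (W i k).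
Proof.
rewrite !mxE !(derivationB (der_del _)) !(derivation_div (der_del _)) //=.
by rewrite (del_comm k j (y i)) (del_comm k j (z i)); ring.
Qed.

(** The column u is a derivation [\sum_j u j 0 * del j] that kills all the forms.
Since they are closed, applying it to the coefficients of a relation gives a
relation; this is the computation with Lie derivatives in coordinates. *)
Let derive_relation (c : 'rV[E]_N) (u : 'cV[E]_d) : c *m W = 0 -> W *m u = 0 ->
  (\row_i \sum_j u j 0 * del j (c 0 i)) *m W = 0.
Proof.
move=> cW Wu.
have cWj j : \sum_i c 0 i * W i j = 0.
  by move/matrixP: cW => /(_ 0 j); rewrite !mxE.
have Wui i : \sum_j W i j * u j 0 = 0.
  by move/matrixP: Wu => /(_ i 0); rewrite !mxE.
apply/rowP=> k; rewrite !mxE.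
have e1 j : \sum_i W i k * del j (c 0 i) = - \sum_i c 0 i * del k (W i j).
  apply/eqP; rewrite -addr_eq0 -big_split /=.
  have := congr1 (del j) (cWj k).
  rewrite (derivation0 (der_del _)) (derivation_sum (der_del _)) => e.
  rewrite -[X in _ == X]e; apply/eqP; apply: eq_bigr => i _.
  by rewrite (derivationM (der_del _)) /= W_closed addrC.
transitivity (\sum_j u j 0 * \sum_i W i k * del j (c 0 i)).
  under eq_bigr do rewrite mxE mulr_suml; rewrite exchange_big.
  apply: eq_bigr => j _; rewrite mulr_sumr; apply: eq_bigr => i _.
  by rewrite mulrAC mulrA.
under eq_bigr do rewrite e1 mulrN mulr_sumr.
rewrite sumrN exchange_big /=.
apply/eqP; rewrite oppr_eq0; apply/eqP.
have e2 i : \sum_j u j 0 * del k (W i j) = - \sum_j W i j * del k (u j 0).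
  apply/eqP; rewrite -addr_eq0 -big_split /=.
  have := congr1 (del k) (Wui i).
  rewrite (derivation0 (der_del _)) (derivation_sum (der_del _)) => e.
  rewrite -[X in _ == X]e; apply/eqP; apply: eq_bigr => j _.
  by rewrite (derivationM (der_del _)) /= addrC.
transitivity (\sum_i c 0 i * \sum_j u j 0 * del k (W i j)).
  by apply: eq_bigr => i _; rewrite mulr_sumr; apply: eq_bigr => j _; rewrite mulrCA.
under eq_bigr do rewrite e2 mulrN mulr_sumr.
rewrite sumrN exchange_big big1 ?oppr0 //= => j _.
under eq_bigr do rewrite mulrA.
by rewrite -mulr_suml cWj mul0r.
Qed.

(** Normalize a relation of minimal support so that a coefficient is 1. The
relations derived from it are shorter, so they vanish: the differentials of the
coefficients are in the row space of W, which the derivations [D s] kill. *)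
Let constant_relation : ~~ row_free W ->
  exists c : 'I_N -> C, (exists i, c i != 0) /\
    forall j, \sum_i kappa (c i) * W i j = 0.
Proof.
rewrite -kermx_eq0 => /rowV0Pn[v /sub_kermxP vW v0].
pose supp (c : 'rV[E]_N) := #|[set i | c 0 i != 0]|.
pose P n := `[< exists c : 'rV[E]_N, [/\ c *m W = 0, c != 0 & supp c = n] >].
have exP : exists n, P n by exists (supp v); apply/asboolP; exists v.
case: (ex_minnP exP) => n /asboolP[c1 [c1W c10 suppc1]] nmin.
have /rV0Pn[i0 c1i0] := c10.
pose c := (c1 0 i0)^-1 *: c1.
have cW : c *m W = 0 by rewrite -scalemxAl c1W scaler0.
have ci0 : c 0 i0 = 1 by rewrite mxE mulVf.
have suppc i : (c 0 i == 0) = (c1 0 i == 0).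
  by rewrite mxE mulf_eq0 invr_eq0 (negPf c1i0).
have duc (u : 'cV[E]_d) i : W *m u = 0 -> \sum_j u j 0 * del j (c 0 i) = 0.
  move=> Wu; set c' := \row_i \sum_j u j 0 * del j (c 0 i).
  suff /rowP/(_ i) : c' = 0 by rewrite !mxE.
  apply: contrapT => /eqP c'0.
  have /nmin : P (supp c') by apply/asboolP; exists c'; rewrite derive_relation.
  rewrite -suppc1 leqNgt => /negP; apply; apply: proper_card.
  rewrite properE; apply/andP; split.
    apply/subsetP=> k; rewrite !inE; apply: contraNN; rewrite -suppc => /eqP ck.
    by rewrite mxE ck big1 // => j _; rewrite (derivation0 (der_del _)) mulr0.
  apply/subsetPn; exists i0; rewrite !inE // negbK mxE ci0 big1 // => j _.
  by rewrite (derivation1 (der_del _)) mulr0.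
have constc i : exists a, c 0 i = kappa a.
  apply: constE => s; rewrite (derivation_expand (der_D s) (DC s)).
  pose dc : 'rV[E]_d := \row_j del j (c 0 i).
  have /submxP[X XE] : (dc <= W)%MS.
    rewrite submxE; apply/eqP/rowP=> k; rewrite !mxE.
    have := duc (col k (cokermx W)) i; rewrite colE mulmxA mulmx_coker mul0mx -colE => /(_ erefl) e.
    by rewrite -[RHS]e; apply: eq_bigr => j _; rewrite !mxE mulrC.
  have /rowP/(_ s) : map_mx iota dc *m T = 0.
    by rewrite XE map_mxM -mulmxA WT mulmx0.
  by rewrite !mxE => e; rewrite -[RHS]e; apply: eq_bigr => j _; rewrite !mxE.
have [a aE] := choice constc.
exists a; split; first by exists i0; rewrite -(fmorph_eq0 kappa) -aE ci0 oner_eq0.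
move=> j; move/rowP: cW => /(_ j); rewrite !mxE => e; rewrite -[RHS]e.
by apply: eq_bigr => i _; rewrite -aE.
Qed.

(** A relation with constant coefficients c says that [\sum_i c i * dz_i / z_i] is
exact. If m is orthogonal to the integral relations of the c, then the residue
theorem forces [\prod_i z i ^ m i] to be constant, hence so is
[\sum_i m i * y i]. *)
Let row_free_W : row_free W.
Proof.
apply: contrapT => /negP/constant_relation[c [[i0 ci0] cW]].
have kci0 : kappa (c i0) != 0 by rewrite fmorph_eq0.
have [m [[i1 mi1] morth]] := relations_orthogonal (c := kappa \o c) E0 kci0.
pose a i := if (0 <= m i)%R then `|m i|%N else 0%N.
pose b i := if (0 <= m i)%R then 0%N else `|m i|%N.
have mE i : m i = (a i)%:Z - (b i)%:Z.
  rewrite /a /b; case: ifPn => [m0|]; first by rewrite subr0 gez0_abs.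
  by rewrite -ltNge => m0; rewrite sub0r ltz0_abs // opprK.
have bnz : \prod_i z i ^+ b i != 0 by apply/prodf_neq0 => i _; rewrite expf_neq0.
pose w := (\prod_i z i ^+ a i) / \prod_i z i ^+ b i.
have wz : w * \prod_i z i ^+ b i = \prod_i z i ^+ a i by rewrite divfK.
have delw j : del j w = 0.
  apply: contrapT => /eqP dw.
  have dxj : del j (x j) != 0 by rewrite delx eqxx oner_eq0.
  have algj : forall (G : fieldType) (phi : {rmorphism G -> E}),
      (forall c, del j c = 0 -> algebraicOver phi c) -> algebraicOver phi (x j) ->
      forall y, algebraicOver phi y.
    move=> G phi aC ax; apply: algE => [c'|i]; first exact/aC/delC.
    have [->//|ij] := eqVneq i j; apply: aC.
    by rewrite delx eq_sym (negPf ij).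
  have dzu i : del j (z i) = z i * (del j (z i) / z i) by rewrite mulrC divfK.
  have csum : \sum_i kappa (c i) * (del j (z i) / z i) = del j (\sum_i kappa (c i) * y i).
    rewrite (derivation_sum (der_del j)); apply/eqP; rewrite eq_sym -subr_eq0 -sumrB.
    rewrite -[X in _ == X](cW j); apply/eqP; apply: eq_bigr => i _.
    by rewrite mxE (derivationM (der_del j)) delC mulr0 addr0 /= mulrBr.
  have [q [/morth qm]] := residue_theorem E0 (der_del j) dxj algj znz dzu
    (fun i => delC j (c i)) csum wz dw.
  rewrite -subr_eq0 -sumrB -[X in _ != X]qm => /eqP; apply; apply: eq_bigr => i _.
  by rewrite mE mulrBr -[(a i)%:Z]natz -[(b i)%:Z]natz !mulr_natr.
have Dw s : D s w = 0.
  rewrite (derivation_expand (der_D s) (DC s)) big1 // => j _.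
  by rewrite delw rmorph0 mul0r.
have [c' c'E] : exists c', \sum_i y i *~ m i = kappa c'.
  apply: constE => s; have := congr1 (D s) wz.
  have Dprod (e : 'I_N -> nat) : D s (\prod_i z i ^+ e i) =
      iota (\prod_i z i ^+ e i) * \sum_i D s (y i) *+ e i.
    by apply: (logderiv_prod (der_D s)) => i; apply: (logderivX (der_D s)).
  rewrite (derivationM (der_D s)) Dw mulr0 addr0 !Dprod mulrA -rmorphM wz.
  have wanz : iota (\prod_i z i ^+ a i) != 0.
    by rewrite fmorph_eq0; apply/prodf_neq0 => i _; rewrite expf_neq0.
  move/(mulfI wanz)/eqP; rewrite eq_sym -subr_eq0 -sumrB => /eqP e.
  rewrite (derivation_sum (der_D s)) -[RHS]e; apply: eq_bigr => i _.
  by rewrite mE mulrzBr (derivationB (der_D s)) -!pmulrn !(derivationMn (der_D s)).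
by move: mi1; rewrite (yfree c'E) eqxx.
Qed.

Theorem abstract_ax p (g : 'I_p -> E) :
  (N + \rank (\matrix_(i < p, s < l) D s (g i)) <= d)%N.
Proof.
have -> : \matrix_(i < p, s < l) D s (g i)
    = map_mx iota (\matrix_(i, j) del j (g i)) *m T.
  apply/matrixP=> i s; rewrite !mxE (derivation_expand (der_D s) (DC s)).
  by apply: eq_bigr => j _; rewrite !mxE.
apply: leq_trans (mulmx0_rank_max WT); rewrite mxrank_map.
by rewrite (eqP row_free_W : \rank W = N) leq_add2l mxrankM_maxr.
Qed.
End AbstractAx.

(** * Power series *)

Lemma pchar0_natr_inj (F : fieldType) :
  [pchar F] =i pred0 -> injective (fun n : nat => n%:R : F).
Proof.
move=> F0 m n /eqP; rewrite -subr_eq0 -[m%:R]/(m%:Z%:~R) -[n%:R]/(n%:Z%:~R) -rmorphB.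
by rewrite pchar0_intr_eq0 // subr_eq0 => /eqP[].
Qed.

Section FpsTheory.
Variables (l : nat) (F : fieldType).
Implicit Types f g h : {fps F[l]}.

Definition fps_trunc e f : {mpoly F[l]} := \sum_(m : 'X_{1..l < e}) f m *: 'X_[m].

Lemma fps_truncE e f m : (mdeg m < e)%N -> (fps_trunc e f)@_m = f m.
Proof. exact: mcoeff_mpoly. Qed.

(** The coefficient of m in a product may be computed with polynomials that agree
with the factors in low degree; this reduces statements to polynomials. *)
Lemma fps_mulE e f g (p q : {mpoly F[l]}) m : (mdeg m < e)%N ->
  (forall k : 'X_{1..l}, (mdeg k < e)%N -> f k = p@_k) ->
  (forall k : 'X_{1..l}, (mdeg k < e)%N -> g k = q@_k) ->
  (f * g) m = (p * q)@_m.
Proof.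
move=> me fp gq; rewrite mcoeffM fpsME; apply: eq_bigr => k _.
by rewrite fp ?gq // (leq_trans _ me) // bmdeg.
Qed.

Lemma fpsCE (c : F) m : fpsC l c m = c *+ (m == 0%MM). Proof. by []. Qed.

Lemma fpsCM (c : F) f m : (fpsC l c * f) m = c * f m.
Proof.
rewrite (@fps_mulE (mdeg m).+1 _ _ c%:MP (fps_trunc (mdeg m).+1 f)) //.
- by rewrite mcoeffCM fps_truncE.
- by move=> k _; rewrite mcoeffC fpsCE eq_sym mulr_natr.
by move=> k km; rewrite fps_truncE.
Qed.

Fact fpsC_zmod_morphism : zmod_morphism (@fpsC l F).
Proof. by move=> a b; apply/fpsP=> m; rewrite fpsDE fpsNE !fpsCE mulrnBl. Qed.

Fact fpsC_monoid_morphism : monoid_morphism (@fpsC l F).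
Proof.
by split=> // a b; apply/fpsP=> m; rewrite fpsCM !fpsCE mulrnAr.
Qed.

HB.instance Definition _ := GRing.isZmodMorphism.Build F {fps F[l]} (@fpsC l F)
  fpsC_zmod_morphism.
HB.instance Definition _ := GRing.isMonoidMorphism.Build F {fps F[l]} (@fpsC l F)
  fpsC_monoid_morphism.

Definition fps_const f : F := f 0%MM.

Fact fps_const_zmod_morphism : zmod_morphism fps_const.
Proof. by []. Qed.

Fact fps_const_monoid_morphism : monoid_morphism fps_const.
Proof.
split=> [|f g]; first by rewrite /fps_const fps1E eqxx.
rewrite /fps_const (@fps_mulE 1 _ _ (fps_trunc 1 f) (fps_trunc 1 g)) ?mdeg0 //;
  try by move=> k km; rewrite fps_truncE.
by rewrite rmorphM /= !fps_truncE ?mdeg0.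
Qed.

HB.instance Definition _ := GRing.isZmodMorphism.Build {fps F[l]} F fps_const
  fps_const_zmod_morphism.
HB.instance Definition _ := GRing.isMonoidMorphism.Build {fps F[l]} F fps_const
  fps_const_monoid_morphism.

Lemma fps_constC (c : F) : fps_const (fpsC l c) = c.
Proof. by rewrite /fps_const fpsCE eqxx. Qed.

Lemma fps_derivE s f m : fps_deriv s f m = f (m + U_(s))%MM *+ (m s).+1.
Proof. by []. Qed.

Lemma fps_deriv_der s : is_deriv idfun (@fps_deriv l F s).
Proof.
split=> f g; apply/fpsP=> m; first by rewrite !fpsDE !fps_derivE fpsDE mulrnDl.
set e := (mdeg m).+2; pose t := fps_trunc e.
have tE h k : (mdeg k < e)%N -> h k = (t h)@_k by move=> ke; rewrite fps_truncE.
have dE h k : (mdeg k < (mdeg m).+1)%N -> fps_deriv s h k = ((t h)^`M(s))@_k.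
  by move=> km; rewrite mcoeff_deriv fps_derivE tE // mdegD mdeg1 addn1.
have tE' h k : (mdeg k < (mdeg m).+1)%N -> h k = (t h)@_k.
  by move=> km; apply: tE; apply: ltnW.
suff : fps_deriv s (f * g) m = (f * fps_deriv s g) m + (g * fps_deriv s f) m by [].
have mU : (mdeg (m + U_(s))%MM < e)%N by rewrite mdegD mdeg1 addn1.
rewrite fps_derivE (@fps_mulE e _ _ (t f) (t g)) //; try exact: tE.
rewrite -mcoeff_deriv mderivM mcoeffD [RHS]addrC.
rewrite (@fps_mulE (mdeg m).+1 f _ (t f) (t g)^`M(s)) //; try exact: dE; try exact: tE'.
rewrite (@fps_mulE (mdeg m).+1 g _ (t g) (t f)^`M(s)) //; try exact: dE; try exact: tE'.
by rewrite [t g * _]mulrC.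
Qed.

Lemma fps_derivC s (c : F) : fps_deriv s (fpsC l c) = 0.
Proof.
apply/fpsP=> m; rewrite fps_derivE fpsCE fps0E.
by rewrite -mdeg_eq0 mdegD mdeg1 addn1 /= mul0rn.
Qed.

Lemma fps_lead f : f != 0 ->
  exists2 m, f m != 0 & forall k : 'X_{1..l}, (k < m)%O -> f k = 0.
Proof.
move=> f0; apply: contrapT => noM; case/eqP: f0; apply/fpsP=> m.
rewrite fps0E; move: m; apply: ltmwf => m IH; apply: contrapT => /eqP fm.
by apply: noM; exists m.
Qed.

(** For the monomial order, lowest terms are multiplicative. *)
Lemma fps_leadM f g a b : (forall k, (k < a)%O -> f k = 0) ->
  (forall k, (k < b)%O -> g k = 0) -> (f * g) (a + b)%MM = f a * g b.
Proof.
move=> fa gb.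
have aD : (mdeg a < (mdeg (a + b)%MM).+1)%N by rewrite mdegD ltnS leq_addr.
have bD : (mdeg b < (mdeg (a + b)%MM).+1)%N by rewrite mdegD ltnS leq_addl.
rewrite fpsME (bigD1 (BMultinom aD, BMultinom bD)) //= big1 ?addr0 //.
move=> [[a' a'D] [b' b'D]] /= /andP[/eqP abE ne].
case: (ltgtP a' a) => [lt|gt|eq].
- by rewrite fa ?mul0r.
- rewrite (gb b') ?mulr0 // ltNge; apply/negP => le.
  by have := ltmc_le_add gt le; rewrite abE ltxx.
have bE : b' = b.
  by apply/eqP; rewrite -(eqm_add2l a) -{1}eq eq_sym; apply/eqP.
by case/negP: ne; rewrite xpair_eqE -!val_eqE /= eq bE !eqxx.
Qed.

Lemma fps_orderM a b f g m : (forall k : 'X_{1..l}, (mdeg k < a)%N -> f k = 0) ->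
  (forall k : 'X_{1..l}, (mdeg k < b)%N -> g k = 0) -> (mdeg m < a + b)%N -> (f * g) m = 0.
Proof.
move=> fa gb mab; rewrite fpsME big1 // => -[m1 m2] /= /eqP mE.
have mD : mdeg m = (mdeg m1 + mdeg m2)%N by rewrite -mdegD; congr mdeg.
have [/fa ->|am1] := ltnP (mdeg m1) a; first by rewrite mul0r.
rewrite gb ?mulr0 // -(ltn_add2l a); apply: leq_ltn_trans mab.
by rewrite [X in (_ <= X)%N]mD leq_add2r.
Qed.

(** Multiplying d/dt_s by t_s yields the Euler operator, which preserves
monomials, so that lowest terms are easy to follow. *)
Definition fps_var s : {fps F[l]} := FPS (fun m => 'X_s@_m).

Lemma mpoly_euler s (p : {mpoly F[l]}) m : ('X_s * p^`M(s))@_m = p@_m *+ m s.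
Proof.
rewrite [in LHS](mpolyE p) [in RHS](mpolyE p) !raddf_sum /= mulr_sumr raddf_sum /=.
rewrite -sumrMnl; apply: eq_bigr => k _.
rewrite mderivZ mderivX !mcoeffZ -!scalerAr !mcoeffZ mcoeffX -mulrnAr; congr (_ * _).
have [k0|k0] := posnP (k s).
  rewrite k0 mul0r; have [<-|] := eqVneq; last by rewrite mul0rn.
  by rewrite k0 mulr0n.
rewrite -mpolyXD mcoeffX addmC submK; last first.
  by apply/mnm_lepP => i; rewrite mnm1E; case: eqP => // <-.
by have [->|_] := eqVneq k m; rewrite ?mulr1 // mulr0 mul0rn.
Qed.

Lemma fps_euler s f m : (fps_var s * fps_deriv s f) m = f m *+ m s.
Proof.
pose t := fps_trunc (mdeg m).+2.
rewrite (@fps_mulE (mdeg m).+1 _ _ 'X_s (t f)^`M(s)) //.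
  by rewrite mpoly_euler fps_truncE.
by move=> k km; rewrite mcoeff_deriv fps_derivE fps_truncE // mdegD mdeg1 addn1.
Qed.

Hypothesis F0 : [pchar F] =i pred0.

(** Subtract a multiple of g from f to kill the coefficient of the lowest
monomial b of g. If the difference h is not zero, with lowest monomial a, the
terms in a + b of g * (t_s dh/dt_s) = h * (t_s dg/dt_s) give a = b: this is
impossible as h has no term in b. *)
Lemma fps_constant_ratio f g : g != 0 ->
  (forall s, g * fps_deriv s f = f * fps_deriv s g) -> exists c, f = fpsC l c * g.
Proof.
move=> g0 fg; have [b gb gbP] := fps_lead g0.
exists (f b / g b); set c := f b / g b; apply/eqP; rewrite -subr_eq0.
set h := f - _; apply: contraT => /fps_lead[a ha haP].
have hb : h b = 0 by rewrite fpsDE fpsNE fpsCM divfK ?subrr.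
have hg s : g * fps_deriv s h = h * fps_deriv s g.
  have der := fps_deriv_der s.
  rewrite (derivationB der) (derivationM der) fps_derivC /= mulr0 addr0.
  by rewrite mulrBr fg /h mulrBl mulrCA mulrA.
have ab : a = b.
  apply/mnmP=> s; have e := congr1 ( *%R (fps_var s)) (hg s).
  have := congr1 (fun u : {fps F[l]} => u (b + a)%MM) e.
  rewrite [in LHS]mulrCA [in RHS]mulrCA (fps_leadM gbP).
    rewrite [(b + a)%MM]addmC (fps_leadM haP).
      rewrite !fps_euler !mulrnAr [h a * _]mulrC => /eqP.
      rewrite -[X in X == _]mulr_natr -[X in _ == X]mulr_natr.
      rewrite -subr_eq0 -mulrBr mulf_eq0 mulf_eq0 (negPf gb) (negPf ha) /= subr_eq0.
      by rewrite (inj_eq (pchar0_natr_inj F0)) => /eqP.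
    by move=> k kb; rewrite fps_euler gbP ?mul0rn.
  by move=> k ka; rewrite fps_euler haP ?mul0rn.
by move: ha; rewrite ab hb eqxx.
Qed.
End FpsTheory.

(** * The derivations of an algebraic closure *)

Section FpsAlgebraic.
Variables (l : nat) (F : closedFieldType) (L : fieldType).
Local Notation S := {fps F[l]}.
Local Notation K := {fraction S}.
Variable iota : {rmorphism K -> L}.
Hypotheses (F0 : [pchar F] =i pred0) (iota_alg : forall y, algebraicOver iota y).

Lemma fps_fraction_pchar0 : [pchar K] =i pred0.
Proof. by move=> p; rewrite (fmorph_pchar (@tofrac S \o @fpsC l F : {rmorphism F -> K})) F0. Qed.

Let tofrac_inj : injective (@tofrac S).
Proof. by move=> a b /eqP; rewrite tofrac_eq => /eqP. Qed.

Let frac_map_id y : frac_map tofrac_inj y = y.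
Proof.
have [/= b0 ->] := frac_repP y; move: (frac_rep y) b0 => [a b] /= b0.
by rewrite frac_mapE.
Qed.

Lemma fraction_fps_derivation s : exists dK : K -> K,
  is_deriv idfun dK /\ forall a, dK (tofrac a) = tofrac (fps_deriv s a).
Proof.
have der : is_deriv (@tofrac S) (fun a => tofrac (fps_deriv s a)).
  have dS := @fps_deriv_der l F s.
  by split=> a b; rewrite ?(derivationD dS) ?(derivationM dS) /= rmorphD ?rmorphM.
have [dK [derK dKE]] := fraction_derivation tofrac_inj der.
exists dK; split=> //; split=> a b; first exact: (derivationD derK).
by rewrite (derivationM derK); congr (_ * _ + _ * _); apply: frac_map_id.
Qed.

Lemma fraction_fps_constant (dK : 'I_l -> K -> K) :
  (forall s, is_deriv idfun (dK s)) ->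
  (forall s a, dK s (tofrac a) = tofrac (fps_deriv s a)) ->
  forall y, (forall s, dK s y = 0) -> exists c : F, y = tofrac (fpsC l c).
Proof.
move=> derK dKE y; have [/= b0 ->] := frac_repP y.
move: (frac_rep y) b0 => [a b] /= b0 dy.
have tb0 : tofrac b != 0 :> K by rewrite tofrac_eq0.
have [s|c aE] := fps_constant_ratio F0 (f := a) b0.
  have := dy s; rewrite (derivation_div (derK s)) // !dKE /= => /eqP.
  rewrite mulf_eq0 invr_eq0 expf_eq0 (negPf tb0) andbF orbF subr_eq0.
  by rewrite -!rmorphM tofrac_eq => /eqP e; rewrite mulrC e.
by exists c; rewrite aE tofracM mulfK.
Qed.

(** If all the derivations kill y, then differentiating the minimal polynomial of
y yields a polynomial of smaller degree that vanishes at y, hence 0. Its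
coefficients are thus in F, and so is y because F is algebraically closed. *)
Lemma fps_algebraic_derivations : exists D : 'I_l -> L -> L,
  [/\ forall s, is_deriv idfun (D s),
      forall s a, D s (iota (tofrac a)) = iota (tofrac (fps_deriv s a))
    & forall y, (forall s, D s y = 0) -> exists c : F, y = iota (tofrac (fpsC l c))].
Proof.
have /choice[dK dKP] := fraction_fps_derivation.
have /choice[D DP] s : exists Ds : L -> L, is_deriv idfun Ds /\
    forall a, Ds (iota a) = iota (dK s a).
  have [derK _] := dKP s.
  have derL : is_deriv iota (iota \o dK s).
    split=> a b /=; first by rewrite (derivationD derK) rmorphD.
    by rewrite (derivationM derK) rmorphD !rmorphM.
  have [Ds [DsE DsD DsM _]] := derivation_extension fps_fraction_pchar0 derL.
  by exists Ds; split=> //; split=> a b; [apply: DsD | apply: DsM].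
exists D; split=> [s|s a|y Dy]; first by have [] := DP s.
  by have [_ ->] := DP s; have [_ ->] := dKP s.
have [p [pmonic py pmin _]] := minimal_polyP fps_fraction_pchar0 (iota_alg y).
have constp i : exists c : F, p`_i = tofrac (fpsC l c).
  apply: (fraction_fps_constant (dK := dK)) => [s|s a|s].
  - by have [] := dKP s.
  - by have [] := dKP s.
  have [derK _] := dKP s; have [derD DE] := DP s.
  have dK0 := derivation0 derK.
  suff dp0 : map_poly (dK s) p = 0 by rewrite -(coef_map_id0 _ _ dK0) dp0 coef0.
  apply: contrapT => /eqP dp0.
  have /pmin/dvdp_leq : root (map_poly iota (map_poly (dK s) p)) y.
    rewrite rootE; have := derivation_horner iota derD p y.
    rewrite (rootP py) (derivation0 derD) Dy mulr0 addr0 /= => /esym e.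
    rewrite -[X in _ == X]e; apply/eqP; congr (_.[_]); apply/polyP=> j.
    rewrite [LHS]coef_map [in LHS]coef_map_id0 // [RHS]coef_map_id0 /= ?DE //.
    by rewrite dK0 rmorph0.
  move=> /(_ dp0); apply/negP; rewrite -ltnNge.
  have pnz := monic_neq0 pmonic.
  rewrite -(prednK (n := size p)) ?size_poly_gt0 // ltnS.
  apply/leq_sizeP => j; rewrite leq_eqVlt => /predU1P[<-|lt].
    by rewrite coef_map_id0 // -lead_coefE (monicP pmonic) (derivation1 derK).
  rewrite coef_map_id0 // nth_default // -(prednK (n := size p)) //.
  by rewrite size_poly_gt0.
have [c cE] := choice constp.
pose q := \poly_(i < size p) c i.
pose h : {rmorphism F -> K} := @tofrac S \o @fpsC l F.
have pE : p = map_poly h q.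
  apply/polyP=> i; rewrite coef_map coef_poly /=; case: ltnP => [_|le]; first exact: cE.
  by rewrite nth_default // !rmorph0.
have [r rE] := closed_field_poly_normal q.
have q1 : lead_coef q = 1.
  by apply: (fmorph_inj h); rewrite -lead_coef_map -pE (monicP pmonic) rmorph1.
move: py; rewrite pE rE q1 scale1r -map_poly_comp.
rewrite rmorph_prod rootE horner_prod => /eqP/eqP.
rewrite (big_nth 0) big_mkord => /prodf_eq0[i _].
rewrite /= rmorphB /= map_polyX map_polyC hornerXsubC subr_eq0 => /eqP ->.
by exists r`_i.
Qed.
End FpsAlgebraic.

(** * Exponentials of eigenvalues *)

Section Exponential.
Variables (l : nat) (F : fieldType).
Local Notation S := {fps F[l]}.
Implicit Types (p q : {poly S}).

(** These are the powers of the ideal of the variables, extended to polynomials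
with power series coefficients. *)
Definition high_order (e : nat) p := forall k m, (mdeg m < e)%N -> p`_k m = 0.

Lemma high_order_add e p q : high_order e p -> high_order e q -> high_order e (p + q).
Proof. by move=> hp hq k m me; rewrite coefD fpsDE hp ?hq ?addr0. Qed.

Lemma high_order_mul e p q : high_order e p -> high_order e (p * q).
Proof.
move=> hp k m me; rewrite coefM fps_sumE big1 // => i _.
by apply: (fps_orderM (a := e) (b := 0)) => [k'|//|]; [apply: hp|rewrite addn0].
Qed.

Lemma high_order_opp e p : high_order e p -> high_order e (- p).
Proof. by rewrite -mulrN1; apply: high_order_mul. Qed.

Lemma high_order_deriv e p : high_order e p -> high_order e p^`().
Proof.
move=> hp k m me; rewrite coef_deriv -mulr_natr.
have := high_order_mul k.+1%:R%:P hp k.+1 me; rewrite coefMC; exact.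
Qed.

Lemma high_order_map_deriv s e p :
  high_order e.+1 p -> high_order e (map_poly (fps_deriv s) p).
Proof.
move=> hp k m me; rewrite coef_map_id0; last exact: derivation0 (fps_deriv_der F s).
by rewrite fps_derivE hp ?mul0rn // mdegD mdeg1 addn1.
Qed.

Lemma high_order_sum e I (r : seq I) (G : I -> {poly S}) :
  (forall i, high_order e (G i)) -> high_order e (\sum_(i <- r) G i).
Proof.
by move=> hG; elim/big_rec: _ => [k m _|i x _]; [rewrite coef0|apply: high_order_add].
Qed.

Lemma high_order_eq0 p : (forall e, high_order e p) -> p = 0.
Proof. by move=> hp; apply/polyP=> k; apply/fpsP=> m; rewrite coef0 (hp (mdeg m).+1). Qed.

Import Pdiv.CommonRing Pdiv.RingMonic.

(** The remainder of the division by chi is linear over power series, so it does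
not decrease orders: the remainder of G has arbitrarily large order. *)
Lemma monic_ideal_closed (chi G : {poly S}) : chi \is monic ->
  (forall e, exists p q, high_order e p /\ G = p + q * chi) ->
  exists q, G = q * chi.
Proof.
move=> chim HG; exists (rdivp G chi); rewrite {1}(rdivp_eq chim G).
suff -> : rmodp G chi = 0 by rewrite addr0.
apply: high_order_eq0 => e; have [p [q [hp ->]]] := HG e.
rewrite rmodpD // rmodp_mull // addr0 -[p]coefK poly_def rmodp_sum //.
apply: high_order_sum => i; rewrite rmodpZ // -mul_polyC.
apply: high_order_mul => k m me; rewrite coefC.
by case: ifP => _; rewrite ?hp.
Qed.

Section Remainders.
Variables (M : nat) (P : {poly S}).
Hypotheses (M0 : (0 < M)%N) (PM : P`_M = 1) (Psize : size P = M.+1)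
  (Pconst : forall k, (k < M)%N -> fps_const P`_k = 0).

(** The remainder of 'X^r modulo P, by a recursion that keeps track of the orders
of its coefficients. *)
Fixpoint Xrem (r : nat) : {poly S} :=
  if r is r'.+1 then 'X * Xrem r' - (Xrem r')`_M.-1 *: P else 1.

Lemma coef_XremS r k : (Xrem r.+1)`_k =
  (if k is k'.+1 then (Xrem r)`_k' else 0) - (Xrem r)`_M.-1 * P`_k.
Proof. by rewrite /= coefB coefXM coefZ; case: k. Qed.

Lemma Xrem_small r k : (M <= k)%N -> (Xrem r)`_k = 0.
Proof.
elim: r k => [|r IH] k Mk.
  by rewrite coef1; case: k Mk => //; rewrite leqNgt M0.
rewrite coef_XremS; case: k Mk => [|k]; first by rewrite leqNgt M0.
rewrite leq_eqVlt => /predU1P[Mk|Mk].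
  by rewrite -Mk PM mulr1 Mk subrr.
by rewrite IH // (nth_default 0 (n := k.+1)) ?Psize // mulr0 subr0.
Qed.

(** With weight 1 for X and M for the variables t_s, every term of P has weight at
least M, as its lower coefficients have no constant term. Each step of the
recursion hence raises the weight, and all the terms of [Xrem r] have weight at
least r. *)
Lemma Xrem_order r k m : (M * mdeg m + k < r)%N -> (Xrem r)`_k m = 0.
Proof.
elim: r k m => [//|r IH] k m kr; rewrite coef_XremS fpsDE fpsNE.
rewrite [X in X - _](_ : _ = 0) ?sub0r; last first.
  by case: k kr => // k; rewrite addnS ltnS => kr; apply: IH.
apply/eqP; rewrite oppr_eq0; apply/eqP.
have M1 : M.-1.+1 = M by rewrite prednK.
have [kM|Mk|kM] := ltngtP k M.
- apply: (fps_orderM (a := mdeg m) (b := 1)); last by rewrite addn1.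
    move=> k' k'm; apply: IH; rewrite -addnS M1 -mulnSr.
    apply: (@leq_trans (M * mdeg m)%N); first by rewrite leq_mul2l k'm orbT.
    by rewrite -ltnS (leq_ltn_trans _ kr) // leq_addr.
  by move=> k'; rewrite ltnS leqn0 mdeg_eq0 => /eqP ->; apply: Pconst.
- by rewrite (nth_default 0 (n := k)) ?Psize // mulr0.
by rewrite kM PM mulr1 IH // -addnS M1 -ltnS -[X in (_ + X < _)%N]kM.
Qed.

Lemma XremE r : exists Q, Xrem r = 'X^r + Q * P.
Proof.
elim: r => [|r [Q QE]]; first by exists 0; rewrite mul0r addr0.
exists ('X * Q - ((Xrem r)`_M.-1)%:P).
by rewrite /= {1}QE exprS mulrDr mulrBl mul_polyC mulrA addrA.
Qed.

Definition exp_trunc T : {poly S} := \sum_(r < T) fpsC l (r`!%:R)^-1 *: Xrem r.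

(** The remainder of exp(X) modulo P. By [Xrem_order] the terms with larger r do
not contribute to the coefficient of m. *)
Definition exp_rem : {poly S} := \poly_(k < M) FPS (fun m =>
  \sum_(r < M * mdeg m + M) (r`!%:R)^-1 * (Xrem r)`_k m).

Lemma exp_remE T k m : (M * mdeg m + M <= T)%N -> exp_rem`_k m = (exp_trunc T)`_k m.
Proof.
move=> mT; rewrite coef_poly coef_sum fps_sumE.
have cE r : (fpsC l (r`!%:R)^-1 *: Xrem r)`_k m = (r`!%:R)^-1 * (Xrem r)`_k m.
  by rewrite coefZ fpsCM.
under [RHS]eq_bigr do rewrite cE.
case: ltnP => [kM|Mk]; last first.
  by rewrite big1 // => r _; rewrite Xrem_small // mulr0.
rewrite /= (big_ord_widen T (fun r => (r`!%:R)^-1 * (Xrem r)`_k m)) //.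
rewrite big_mkcond; apply: eq_bigr => r _; case: ifPn => //.
by rewrite -leqNgt => mr; rewrite Xrem_order ?mulr0 // (leq_trans _ mr) // ltn_add2l.
Qed.

Lemma exp_rem_high T e : (M * e <= T)%N -> high_order e (exp_rem - exp_trunc T).
Proof.
move=> eT k m me; rewrite coefB fpsDE fpsNE (@exp_remE T) ?subrr //.
by apply: leq_trans eT; rewrite -mulnSr leq_mul2l me orbT.
Qed.

Lemma Xrem_high r e : (M * e <= r)%N -> high_order e (Xrem r).
Proof.
move=> er k m me; have [Mk|kM] := leqP M k; first by rewrite Xrem_small.
apply: Xrem_order; apply: leq_trans er; apply: (@leq_trans (M * mdeg m + M)%N).
  by rewrite ltn_add2l.
by rewrite -mulnSr leq_mul2l me orbT.
Qed.
End Remainders.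

Section MatrixExponential.
Hypothesis F0 : [pchar F] =i pred0.
Variables (n' : nat).
Local Notation n := n'.+1.
Variable A : 'M[S]_n.
Hypothesis A0 : forall i j, A i j 0%MM = 0.

Local Notation chi := (char_poly A).
Local Notation M := (n + n)%N.
Local Notation P := (chi * chi).

Lemma char_poly_const : map_poly (@fps_const l F) chi = 'X^n.
Proof.
rewrite map_char_poly /=.
have -> : map_mx (@fps_const l F) A = 0 by apply/matrixP=> i j; rewrite !mxE; apply: A0.
by rewrite /char_poly /char_poly_mx map_mx0 subr0 det_scalar.
Qed.

Let M0 : (0 < M)%N. Proof. by []. Qed.

Let chi_monic : chi \is monic. Proof. exact: char_poly_monic. Qed.

Let P_size : size P = M.+1.
Proof. by rewrite size_monicM ?monic_neq0 // size_char_poly addnS. Qed.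

Let PM : P`_M = 1.
Proof.
have /monicP : P \is monic by rewrite monicMl.
by rewrite lead_coefE P_size.
Qed.

Let P_const k : (k < M)%N -> fps_const P`_k = 0.
Proof.
move=> kM; rewrite -coef_map rmorphM /= char_poly_const -exprD coefXn.
by rewrite ltn_eqF.
Qed.

Definition exp_poly := exp_rem M P.
Local Notation H := exp_poly.

(** The truncated exponential series. *)
Let E_trunc T : {poly S} := \sum_(r < T) fpsC l (r`!%:R)^-1 *: 'X^r.

Let exp_truncE T : exists Q, exp_trunc M P T = E_trunc T + Q * P.
Proof.
have /choice[Q QE] := XremE M P.
exists (\sum_(r < T) fpsC l (r`!%:R)^-1 *: Q r).
rewrite /exp_trunc /E_trunc [X in _ = _ + X]mulr_suml -big_split; apply: eq_bigr => r _ /=.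
by rewrite QE scalerDr scalerAl.
Qed.

Let E_trunc_deriv T : (E_trunc T.+1)^`() = E_trunc T.
Proof.
rewrite /E_trunc raddf_sum big_ord_recl /= derivZ derivXn mulr0n scaler0 add0r.
apply: eq_bigr => r _; rewrite derivZ derivXn /= -scaler_nat scalerA; congr (_ *: _).
rewrite -(rmorph_nat (@fpsC l F)) -rmorphM /= factS natrM invfM mulrAC mulVf ?mul1r //.
by have /pcharf0P -> := F0.
Qed.

Let E_trunc_map_deriv s T : map_poly (fps_deriv s) (E_trunc T) = 0.
Proof.
have D0 := derivation0 (fps_deriv_der F s).
apply/polyP=> k; rewrite coef_map_id0 // coef0 coef_sum.
rewrite (derivation_sum (fps_deriv_der F s)) big1 // => r _.
rewrite coefZ coefXn mulr_natr (derivationMn (fps_deriv_der F s)).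
by rewrite fps_derivC mul0rn.
Qed.

(** Truncate the series: the derivative of 'X^r / r! is the preceding term, and the
derivative of a multiple of chi ^ 2 is a multiple of chi. This is why the
remainder is taken modulo chi ^ 2. The last term of the truncation is small
modulo chi, and the multiples of chi form a closed ideal. *)
Lemma exp_poly_deriv : exists q, H^`() - H = q * chi.
Proof.
apply: (monic_ideal_closed chi_monic) => e; pose T := (M * e)%N.
have [h [hh HE]] : exists h, high_order e h /\ H = h + exp_trunc M P T.+1.
  exists (H - exp_trunc M P T.+1); split; last by rewrite subrK.
  by apply: (exp_rem_high M0 PM P_size P_const); apply: leqnSn.
have [Q QE] := exp_truncE T.+1.
have [Q' Q'E] := XremE M P T.
pose a : {poly S} := (fpsC l (T`!%:R)^-1)%:P.
exists (h^`() - h - a * Xrem M P T).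
exists (Q^`() * chi + Q * chi^`() *+ 2 - Q * chi + a * Q' * chi).
split.
  apply: high_order_add; last apply: high_order_opp.
    by apply: high_order_add; [apply: high_order_deriv|apply: high_order_opp].
  by rewrite mulrC; apply: high_order_mul; apply: (Xrem_high M0 PM P_size P_const).
have ES : E_trunc T.+1 = E_trunc T + a * 'X^T by rewrite /E_trunc big_ord_recr /= -mul_polyC.
rewrite HE QE !derivD E_trunc_deriv ES Q'E !derivM.
by move: (chi) (chi^`()) => c c'; ring.
Qed.

Lemma exp_poly_map_deriv s : exists q, map_poly (fps_deriv s) H = q * chi.
Proof.
have der := map_poly_derivation (fps_deriv_der F s).
apply: (monic_ideal_closed chi_monic) => e; pose T := (M * e.+1)%N.
have [h [hh HE]] : exists h, high_order e.+1 h /\ H = h + exp_trunc M P T.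
  exists (H - exp_trunc M P T); split; last by rewrite subrK.
  exact: (exp_rem_high M0 PM P_size P_const).
have [Q QE] := exp_truncE T.
exists (map_poly (fps_deriv s) h).
exists (map_poly (fps_deriv s) Q * chi + Q * map_poly (fps_deriv s) chi *+ 2).
split; first exact: high_order_map_deriv.
rewrite HE QE !(derivationD der) E_trunc_map_deriv add0r; congr (_ + _).
have idE (p : {poly S}) : map_poly idfun p = p by apply: map_poly_id.
rewrite !(derivationM der) /= !idE.
by move: (map_poly (fps_deriv s) chi) (chi) => c' c; ring.
Qed.

Lemma horner_mx_high e p i j m : high_order e p -> (mdeg m < e)%N ->
  horner_mx A p i j m = 0.
Proof.
move=> hp me; rewrite -[p]coefK poly_def rmorph_sum summxE fps_sumE big1 // => k _.
rewrite /= linearZ /= rmorphXn /= horner_mx_X mxE.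
by apply: (fps_orderM (a := e) (b := 0)) => [k'|//|]; [apply: hp|rewrite addn0].
Qed.

(** The truncations of both sides agree by Cayley-Hamilton, and they are close to
both sides. *)
Lemma mexp_horner : mexp A = horner_mx A H.
Proof.
apply/matrixP=> i j; apply/fpsP=> m; pose e := (mdeg m).+1; pose T := (M * e)%N.
have := horner_mx_high i j (exp_rem_high M0 PM P_size P_const (leqnn T)) (ltnSn (mdeg m)).
have subE (B C : 'M[S]_n) : (B - C) i j = B i j - C i j by rewrite !mxE.
rewrite -/H rmorphB /= subE fpsDE fpsNE => /eqP.
rewrite subr_eq0 => /eqP ->.
have [Q ->] := exp_truncE T.
rewrite rmorphD !rmorphM /= Cayley_Hamilton !mulr0 addr0.
rewrite (@mexp_stable _ _ _ _ _ _ _ T A0); last first.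
  by apply: leq_trans (_ : (e <= T)%N) => //; rewrite leq_pmull.
rewrite rmorph_sum summxE fps_sumE; apply: eq_bigr => r _.
by rewrite /= linearZ /= rmorphXn /= horner_mx_X mxE fpsCM.
Qed.

(** The constant term of the exponential is the identity matrix. *)
Lemma det_mexp_neq0 : \det (mexp A) != 0.
Proof.
apply: contraTneq (oner_neq0 F) => d0; rewrite negbK -(det1 F n).
have -> : 1%:M = map_mx (@fps_const l F) (mexp A).
  apply/matrixP=> i j; rewrite !mxE /fps_const /=.
  rewrite mdeg0 big_ord1 expr0 fact0 invr1 mul1r mxE.
  by case: (i == j); rewrite ?fps1E ?eqxx ?fps0E.
by rewrite det_map_mx d0 rmorph0.
Qed.

Variables (L : fieldType) (iota : {rmorphism {fraction S} -> L}).
Variables (D : 'I_l -> L -> L).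
Hypotheses (derD : forall s, is_deriv idfun (D s))
  (DE : forall s a, D s (iota (tofrac a)) = iota (tofrac (fps_deriv s a))).

Local Notation j := (iota \o @tofrac S).

(** Take e = H(f). An eigenvector of A for f is one of E(A) = H(A) for H(f), and
the chain rule, together with the congruences for the derivatives of H modulo
chi, gives the derivatives of e. *)
Lemma eigenvalue_exp f : root (char_poly (map_mx j A)) f ->
  exists e, [/\ root (char_poly (map_mx j (mexp A))) e, e != 0
    & forall s, D s e = e * D s f].
Proof.
rewrite -eigenvalue_root_char => /eigenvalueP[v vA v0].
have chif : (map_poly j chi).[f] = 0.
  apply/rootP; rewrite map_char_poly -eigenvalue_root_char.
  by apply/eigenvalueP; exists v.
exists (map_poly j H).[f].
have vexp : v *m map_mx j (mexp A) = (map_poly j H).[f] *: v.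
  rewrite mexp_horner map_horner_mx.
  have vAk k : v *m map_mx j A ^+ k = f ^+ k *: v.
    elim: k => [|k IH]; first by rewrite !expr0 mulmx1 scale1r.
    by rewrite exprS mulmxA vA -scalemxAl IH scalerA exprS.
  rewrite -[map_poly j H in LHS]coefK poly_def rmorph_sum mulmx_sumr horner_coef.
  rewrite scaler_suml; apply: eq_bigr => k _.
  by rewrite /= linearZ /= rmorphXn /= horner_mx_X -scalemxAr vAk scalerA.
split=> [||s].
- by rewrite -eigenvalue_root_char; apply/eigenvalueP; exists v.
- apply: contraNneq v0 => e0; move: vexp; rewrite e0 scale0r.
  move=> /(congr1 (mulmx^~ (invmx (map_mx j (mexp A))))).
  rewrite mulmxK ?mul0mx => [->//|]; rewrite unitmxE det_map_mx unitfE.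
  by rewrite /= fmorph_eq0 tofrac_eq0 det_mexp_neq0.
rewrite (derivation_horner j (derD s)) /=.
have [q1 q1E] := exp_poly_map_deriv s; have [q2 q2E] := exp_poly_deriv.
have evq q : (map_poly j (q * chi)).[f] = 0 by rewrite rmorphM hornerM chif mulr0.
have -> : map_poly (D s \o j) H = map_poly j (map_poly (fps_deriv s) H).
  apply/polyP=> k; have D0 := derivation0 (fps_deriv_der F s).
  rewrite coef_map !coef_map_id0 //= ?DE //.
  by rewrite D0 tofrac0 rmorph0.
rewrite q1E evq add0r; congr (_ * _).
have -> : H^`() = H + q2 * chi by rewrite -q2E addrC subrK.
by rewrite rmorphD hornerD evq addr0.
Qed.
End MatrixExponential.
End Exponential.

(** The combination is equal to c, so the symmetric polynomial
P = \prod_s (c - \sum_i q_i X_(s i)) vanishes at the eigenvalues. As a polynomial in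
the coefficients of the characteristic polynomial, this value reduces modulo the
variables t to the value of P at 0, since A reduces to 0. Hence a power of c is 0. *)
Lemma eigenvalue_combination (l n : nat) (F L : fieldType)
    (iota : {rmorphism {fraction {fps F[l]}} -> L}) (A : 'M[{fps F[l]}]_n)
    (f : 'I_n -> L) (q : 'I_n -> int) (c : F) :
  (forall i j, A i j 0%MM = 0) ->
  map_poly (iota \o @tofrac _) (char_poly A) = \prod_(i < n) ('X - (f i)%:P) ->
  \sum_i f i *~ q i = iota (tofrac (fpsC l c)) -> c = 0.
Proof.
move=> A0 chiE fc.
pose fac (s : {perm 'I_n}) : {mpoly F[n]} := c%:MP - \sum_i 'X_(s i) *~ q i.
pose P := \prod_(s : {perm 'I_n}) fac s.
have symP : P \is symmetric.
  apply/issymP=> s; rewrite /P rmorph_prod /=.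
  rewrite [RHS](reindex_inj (mulIg s)); apply: eq_bigr => t _.
  have sC : msym s c%:MP = c%:MP :> {mpoly F[n]} by rewrite /msym mmapC.
  have sX i : msym s 'X_i = 'X_(s i) :> {mpoly F[n]} by rewrite /msym mmapX mmap1U.
  rewrite /fac raddfB /= sC; congr (_ - _); rewrite raddf_sum.
  by apply: eq_bigr => i _; rewrite raddfMz /= sX permM.
have facE (M : comNzRingType) (g : {rmorphism F -> M}) (h : 'I_n -> M) s :
    mmap g h (fac s) = g c - \sum_i h (s i) *~ q i.
  rewrite /fac rmorphB /= mmapC; congr (_ - _); rewrite raddf_sum.
  by apply: eq_bigr => i _; rewrite raddfMz /= mmapX mmap1U.
have [T TE] := symmetric_eval symP.
have PT := TE _ _ (@fpsC l F) (iota \o @tofrac _) f (char_poly A) chiE.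
have P0 : mmap ((iota \o @tofrac _) \o @fpsC l F) f P = 0.
  rewrite /P rmorph_prod /=; apply/eqP/prodf_eq0; exists 1%g => //.
  by rewrite facE /= -fc subr_eq0; apply/eqP/eq_bigr => i _; rewrite perm1.
move: PT; rewrite P0 => /esym/eqP; rewrite /= fmorph_eq0 tofrac_eq0 => /eqP T0.
have chi0 : map_poly (@fps_const l F) (char_poly A) = \prod_(i < n) ('X - 0%:P).
  rewrite map_char_poly /=.
  have -> : map_mx (@fps_const l F) A = 0 by apply/matrixP=> i j; rewrite !mxE; apply: A0.
  rewrite /char_poly /char_poly_mx map_mx0 subr0 det_scalar.
  by under eq_bigr do rewrite subr0; rewrite prodr_const card_ord.
have := TE _ _ (@fpsC l F) (@fps_const l F) (fun=> 0) (char_poly A) chi0.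
rewrite T0 rmorph0 /P rmorph_prod /= => /eqP/prodf_eq0[s _].
rewrite facE big1 => [|i _]; last by rewrite mul0rz.
by rewrite subr0 => /eqP c0; rewrite -[LHS](fps_constC l c); exact: c0.
Qed.

(** * The algebraic closure of a purely transcendental extension *)

Lemma algebraic_trans (F G E : fieldType) (phi : {rmorphism F -> E})
    (psi : {rmorphism G -> E}) y :
  (forall a, algebraicOver psi (phi a)) -> algebraicOver phi y -> algebraicOver psi y.
Proof.
move=> aphi [p pnz py]; apply/integral_algebraic.
apply: (integral_root _ py) => [|z /(nthP 0)[i _ <-]]; first by rewrite map_poly_eq0.
by rewrite coef_map; apply/integral_algebraic/aphi.
Qed.

Section ClosedSubfield.
Variables (F : fieldType) (L : closedFieldType) (phi : {rmorphism F -> L}).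

Definition acl := subfield (alg_closure phi).
HB.instance Definition _ := GRing.Field.on acl.

(** A root in L of a polynomial with algebraic coefficients is algebraic. *)
Fact acl_closed : GRing.closed_field_axiom acl.
Proof.
move=> n P n0; have [x xE] := solve_monicpoly (fun i => subfield_val (P i)) n0.
have ax : algebraicOver phi x.
  pose p : {poly L} := 'X^n - \poly_(i < n) subfield_val (P i).
  apply/integral_algebraic; apply: (@integral_root _ _ phi p).
  - apply: contraTneq n0 => p0; have /(congr1 (coefp n)) := p0.
    by rewrite /= coefB coefXn eqxx coef_poly ltnn subr0 coef0 => /eqP; rewrite oner_eq0.
  - rewrite /root /p !hornerE horner_poly xE subr_eq0; apply/eqP.
    by apply: eq_bigr.
  move=> z /(nthP 0)[i _ <-]; rewrite /p coefB coefXn coef_poly.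
  apply/integral_algebraic/algebraic_sub.
    by case: (i == n); [exact: algebraic1|exact: algebraic0].
  case: ifP => _; last exact: algebraic0.
  by apply/asboolP; apply: (subfield_valP (P i)).
have ax' : x \in alg_closure phi by apply/asboolP.
exists (Subfield ax'); apply: val_inj => /=.
by rewrite rmorphXn /= xE rmorph_sum; apply: eq_bigr => i _; rewrite rmorphM rmorphXn.
Qed.

HB.instance Definition _ := Field_isAlgClosed.Build acl acl_closed.
End ClosedSubfield.

Section SubfieldLift.
Variables (A L : fieldType) (S : divringClosed L) (g : {rmorphism A -> L}).

Definition subfield_lift (gS : forall a, g a \in S) a : subfield S := Subfield (gS a).

Variable gS : forall a, g a \in S.

Fact subfield_lift_zmod_morphism : zmod_morphism (subfield_lift gS).
Proof. by move=> a b; apply: val_inj; rewrite /= rmorphB. Qed.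

Fact subfield_lift_monoid_morphism : monoid_morphism (subfield_lift gS).
Proof. by split=> [|a b]; apply: val_inj; rewrite /= ?rmorph1 ?rmorphM. Qed.

HB.instance Definition _ := GRing.isZmodMorphism.Build A (subfield S)
  (subfield_lift gS) subfield_lift_zmod_morphism.
HB.instance Definition _ := GRing.isMonoidMorphism.Build A (subfield S)
  (subfield_lift gS) subfield_lift_monoid_morphism.
End SubfieldLift.

(** The morphism psi maps the variables to algebraically independent elements of
L, and E is the algebraic closure in L of the field that they generate over F. *)
Section TranscendenceBasis.
Variables (F : fieldType) (L : closedFieldType) (d : nat).
Hypothesis F0 : [pchar F] =i pred0.
Variables (psi : {rmorphism {mpoly F[d]} -> L}) (psi_inj : injective psi).

Local Notation phi := (frac_map psi_inj).
Local Notation E := (acl phi).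

Let phi_alg a : phi a \in alg_closure phi.
Proof. by apply/asboolP; apply: algebraic_id. Qed.

Let phiE : {rmorphism {fraction {mpoly F[d]}} -> E} := subfield_lift phi_alg.

Definition acl_const : F -> E := phiE \o @tofrac _ \o @mpolyC d F.
HB.instance Definition _ := GRing.RMorphism.on acl_const.
Definition acl_var (j : 'I_d) : E := phiE (tofrac 'X_j).

Lemma acl_constE c : subfield_val (acl_const c) = psi c%:MP.
Proof. exact: frac_map_tofrac. Qed.

Lemma acl_varE j : subfield_val (acl_var j) = psi 'X_j.
Proof. exact: frac_map_tofrac. Qed.

Lemma acl_generated (G : fieldType) (mu : {rmorphism G -> E}) :
  (forall c, algebraicOver mu (acl_const c)) -> (forall j, algebraicOver mu (acl_var j)) ->
  forall y, algebraicOver mu y.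
Proof.
move=> ac ax y.
have aP u : algebraicOver mu (phiE (tofrac u)).
  have -> : phiE (tofrac u) = mmap acl_const acl_var u.
    apply: (@mpoly_morph_eq _ _ _ (phiE \o @tofrac _) (mmap acl_const acl_var)).
      by move=> c; rewrite /= mmapC.
    by move=> j; rewrite /= mmapX mmap1U.
  apply/asboolP; rewrite -[`[< _ >]]/(_ \in alg_closure mu) /mmap.
  apply: rpred_sum => m _; apply: rpredM; first exact/asboolP.
  by apply: rpred_prod => j _; apply: rpredX; apply/asboolP.
apply: (@algebraic_trans _ _ _ phiE).
  move=> a; have [/= b0 ->] := frac_repP a; rewrite fmorph_div /=.
  by apply: algebraic_div; apply: aP.
have /asboolP[p pnz py] := subfield_valP y; exists p => //.
rewrite rootE -(fmorph_eq0 (@subfield_val _ _ : {rmorphism E -> L})) -horner_map.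
by rewrite -map_poly_comp.
Qed.

(** Extend the partial derivation of polynomials to fractions, then to algebraic
elements, with values in L; the explicit form of the extension shows that the
values are in E. *)
Lemma acl_partial (j : 'I_d) : exists del : E -> E, [/\ is_deriv idfun del,
  forall c, del (acl_const c) = 0 & forall i, del (acl_var i) = (j == i)%:R].
Proof.
have der : is_deriv psi (psi \o mderiv j).
  split=> p q /=; first by rewrite mderivD rmorphD.
  by rewrite mderivM rmorphD !rmorphM /= [RHS]addrC; congr (_ + _); rewrite mulrC.
have [D0 [der0 D0E]] := fraction_derivation psi_inj der.
have D0phi a : exists t, D0 a = phi t.
  have [/= q0 ->] := frac_repP a; move: (frac_rep a) q0 => [p q] /= q0.
  exists ((tofrac p^`M(j) * tofrac q - tofrac p * tofrac q^`M(j)) / tofrac q ^+ 2).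
  rewrite (derivation_div der0) ?tofrac_eq0 // !D0E /=.
  by rewrite !(fmorph_div, rmorphB, rmorphM, rmorphXn) /= !frac_map_tofrac.
have K0 : [pchar {fraction {mpoly F[d]}}] =i pred0.
  by move=> p; rewrite (fmorph_pchar (@tofrac _ \o @mpolyC d F : {rmorphism F -> _})) F0.
have [D [DE DD DM Dalg]] := derivation_extension K0 der0.
have /choice[del delE] (y : E) : exists y' : E, subfield_val y' = D (subfield_val y).
  have ay : algebraicOver phi (subfield_val y) by apply/asboolP; apply: (subfield_valP y).
  suff aDy : D (subfield_val y) \in alg_closure phi by exists (Subfield aDy).
  have [w1 [w2 ->]] := Dalg _ ay.
  have D00 := derivation0 der0.
  apply: rpred_div; apply: rpred_horner; try exact: (subfield_valP y).
    apply/polyOverP=> i; rewrite coef_map_id0 //.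
    by have [t ->] := D0phi w1`_i; apply: phi_alg.
  by apply/polyOverP=> i; rewrite coef_map; apply: phi_alg.
have ya (y : E) : algebraicOver phi (subfield_val y) by apply/asboolP; apply: (subfield_valP y).
exists del; split=> [|c|i].
- split=> a b; apply: val_inj; rewrite [LHS]delE.
    rewrite [RHS](_ : _ = subfield_val (del a) + subfield_val (del b)) // !delE.
    exact: (DD _ _ (ya a) (ya b)).
  rewrite [RHS](_ : _ = subfield_val a * subfield_val (del b)
    + subfield_val b * subfield_val (del a)) // !delE.
  exact: (DM _ _ (ya a) (ya b)).
- apply: val_inj; rewrite /= delE acl_constE -(frac_map_tofrac psi_inj) DE D0E /=.
  by rewrite mderivC rmorph0.
apply: val_inj; rewrite /= delE acl_varE -(frac_map_tofrac psi_inj) DE D0E /=.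
rewrite mderivX mnm1E eq_sym; case: eqVneq => [->|_].
  have -> : (U_(i) - U_(i) = 0)%MM by apply/mnmP=> k; rewrite !mnmE subnn.
  by rewrite mpolyX0 scale1r !rmorph1.
by rewrite scale0r !rmorph0.
Qed.
End TranscendenceBasis.

(** The construction of E is hidden, so that E is used as an abstract closed field
with its embedding iota in L. *)
Lemma transcendence_package (F : fieldType) (L : closedFieldType) (d : nat)
    (psi : {rmorphism {mpoly F[d]} -> L}) (psi_inj : injective psi) :
  [pchar F] =i pred0 ->
  exists (E : closedFieldType) (iota : {rmorphism E -> L}) (kappa : {rmorphism F -> E})
    (x : 'I_d -> E) (del : 'I_d -> E -> E),
  [/\ forall c, iota (kappa c) = psi c%:MP,
      forall y, algebraicOver (frac_map psi_inj) y -> exists y', y = iota y',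
      forall j, is_deriv idfun (del j),
      (forall j c, del j (kappa c) = 0) /\ (forall i j, del i (x j) = (i == j)%:R)
    & forall (G : fieldType) (mu : {rmorphism G -> E}),
        (forall c, algebraicOver mu (kappa c)) -> (forall j, algebraicOver mu (x j)) ->
        forall y, algebraicOver mu y].
Proof.
move=> F0; have /choice[del delP] := acl_partial F0 psi_inj.
exists (acl (frac_map psi_inj)), (@subfield_val _ _), (acl_const psi_inj).
exists (acl_var psi_inj), del; split.
- exact: acl_constE.
- move=> y ay; have ay' : y \in alg_closure (frac_map psi_inj) by apply/asboolP.
  by exists (Subfield ay').
- by move=> j; have [] := delP j.
- by split=> [j c|i j]; [have [_ -> _] := delP j|have [_ _ ->] := delP i].
exact: acl_generated.
Qed.

(** * The theorem for matrices *)

Lemma logderivXz (A L : fieldType) (phi : {rmorphism A -> L}) (D : A -> L) a u (m : int) :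
  is_deriv phi D -> D a = phi a * u -> D (a ^ m) = phi (a ^ m) * (u *~ m).
Proof.
move=> derD Da; case: m => m; first by rewrite -exprnP -pmulrn (logderivX derD m Da).
rewrite NegzE -exprnN (logderivV derD (logderivX derD m.+1 Da)).
by rewrite mulrNz -pmulrn.
Qed.

Lemma root_descend (E L : closedFieldType) (iota : {rmorphism E -> L}) (p : {poly E}) y :
  p != 0 -> root (map_poly iota p) y -> exists y', y = iota y'.
Proof.
move=> pnz; have [r {1}->] := closed_field_poly_normal p.
rewrite map_polyZ rootZ ?fmorph_eq0 ?lead_coef_eq0 //.
rewrite rmorph_prod rootE horner_prod (big_nth 0) big_mkord => /prodf_eq0[i _].
rewrite /= rmorphB /= map_polyX map_polyC hornerXsubC subr_eq0 => /eqP ->.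
by exists r`_i.
Qed.

Lemma ratr_common_denominator (L : fieldType) (D z : int) (q : rat) :
  [pchar L] =i pred0 -> D%:~R * q = z%:~R -> D%:~R * ratr q = z%:~R :> L.
Proof.
move=> L0 Dq; have den0 : (denq q)%:~R != 0 :> L by rewrite pchar0_intr_eq0 // denq_eq0.
rewrite /ratr mulrA; apply: (canLR (mulfK den0)); rewrite -!rmorphM /=; congr _%:~R.
apply: (@intr_inj rat); rewrite !rmorphM /= -Dq -mulrA; congr (_ * _).
have dq0 : (denq q)%:~R != 0 :> rat by rewrite intr_eq0 denq_eq0.
have /(congr1 ( *%R^~ (denq q)%:~R)) := divq_num_den q.
by rewrite /= divfK // => ->.
Qed.

Lemma adjoin_frac_map (F K L : fieldType) (iota : {rmorphism K -> L}) d
    (kappa : {rmorphism F -> K}) (x : 'I_d -> K)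
    (psi_inj : injective (iota \o mmap kappa x)) y :
  adjoin kappa (fun z => exists i, z = x i) y -> exists a, iota y = frac_map psi_inj a.
Proof.
elim=> [c|_ [i ->]|y1 y2 _ [a1 e1] _ [a2 e2]|y1 y2 _ [a1 e1] _ [a2 e2]|y1 _ [a1 e1]].
- by exists (tofrac c%:MP); rewrite frac_map_tofrac /= mmapC.
- by exists (tofrac 'X_i); rewrite frac_map_tofrac /= mmapX mmap1U.
- by exists (a1 - a2); rewrite !rmorphB e1 e2.
- by exists (a1 * a2); rewrite !rmorphM /= e1 e2.
by exists a1^-1; rewrite !fmorphV e1.
Qed.

(** It remains to apply [abstract_ax] to the algebraic closure of F(A, E(A)), with
the entries of A as the elements whose derivatives are considered, integral
combinations y of the eigenvalues of A, and the corresponding products z of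
eigenvalues of E(A). *)
Theorem matrix_ax_schanuel (F L : closedFieldType) (l n : nat) (A : 'M[{fps F[l]}]_n)
    (iota : {rmorphism {fraction {fps F[l]}} -> L}) (f : 'I_n -> L) (N d : nat) :
  [pchar F] =i pred0 -> (forall i j, A i j 0%MM = 0) ->
  (forall x : L, algebraicOver iota x) ->
  char_poly (map_mx iota (map_mx (@tofrac _) A)) = \prod_(i < n) ('X - (f i)%:P) ->
  has_Qdim (Qspan f) N ->
  has_trdeg (fun c : F => tofrac (fpsC l c)) (field_mx_exp A) d ->
  (N + \rank (jacobian A) <= d)%N.
Proof.
move=> F0 A0 iota_alg f_eigen [b [bfree bspan]] [x [xE xfree xalg]].
pose j : {rmorphism {fps F[l]} -> L} := iota \o @tofrac _.
pose k : {rmorphism F -> {fraction {fps F[l]}}} := @tofrac _ \o @fpsC l F.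
have chiE : map_poly j (char_poly A) = \prod_(i < n) ('X - (f i)%:P).
  by rewrite map_char_poly /j map_mx_comp.
have psi_inj : injective (iota \o mmap k x).
  apply: raddf_inj => p /= /eqP; rewrite fmorph_eq0 => /eqP; exact: xfree.
have [E [i [kappa [xi [del [ikappa inE der_del [delC delx] genE]]]]]] :=
  transcendence_package psi_inj F0.
have E0 : [pchar E] =i pred0 by move=> p; rewrite (fmorph_pchar kappa) F0.
have L0 : [pchar L] =i pred0 by move=> p; rewrite (fmorph_pchar i) E0.
have {}ikappa c : i (kappa c) = iota (tofrac (fpsC l c)).
  by rewrite ikappa /= mmapC.
have fieldE y : field_mx_exp A y -> exists y', iota y = i y'.
  move=> /xalg[p [pnz padj py]]; apply: inE; apply/integral_algebraic.
  apply: (@integral_root _ _ _ (map_poly iota p)).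
  - by rewrite map_poly_eq0.
  - by rewrite rootE horner_map (rootP py) rmorph0.
  move=> z /(nthP 0)[m _ <-]; rewrite coef_map; apply/integral_algebraic.
  have [a aE] := adjoin_frac_map psi_inj (padj m).
  exact: (eq_ind_r (algebraicOver _) (algebraic_id (frac_map psi_inj) a) aE).
have /choice[g gE] (r : 'I_n * 'I_n) : exists y, iota (tofrac (A r.1 r.2)) = i y.
  by apply: fieldE; apply: adjoin_gen; exists r.1, r.2; left.
have /choice[h hE] (r : 'I_n * 'I_n) : exists y, iota (tofrac (mexp A r.1 r.2)) = i y.
  by apply: fieldE; apply: adjoin_gen; exists r.1, r.2; right.
pose AE : 'M[E]_n := \matrix_(r, s) g (r, s).
pose XE : 'M[E]_n := \matrix_(r, s) h (r, s).
have AEE : map_mx i AE = map_mx j A by apply/matrixP=> r s; rewrite !mxE -gE.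
have XEE : map_mx i XE = map_mx j (mexp A).
  by apply/matrixP=> r s; rewrite [LHS]mxE [XE r s]mxE -hE [RHS]mxE.
have [D [derD DE Dconst]] := fps_algebraic_derivations F0 iota_alg.
have derDi s : is_deriv i (D s \o i).
  split=> y1 y2 /=; first by rewrite rmorphD (derivationD (derD s)).
  by rewrite rmorphM (derivationM (derD s)).
have /choice[fE fEE] r : exists y, f r = i y.
  apply: (@root_descend _ _ _ (char_poly AE)); first exact/monic_neq0/char_poly_monic.
  rewrite map_char_poly AEE -map_char_poly chiE (bigD1 r) //= rootM.
  by rewrite root_XsubC eqxx.
have /choice[e eP] r : exists e : E, [/\ e != 0
    & forall s, D s (i e) = i e * D s (f r)].
  have [e [eroot e0 De]] : exists e, [/\ root (char_poly (map_mx j (mexp A))) e,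
      e != 0 & forall s, D s e = e * D s (f r)].
    case: (n) A A0 f chiE r {xE xalg f_eigen bspan fieldE g gE h hE AE XE AEE XEE fE fEE}
      => [|n'] B B0 f' chiB r'; first by case: r'.
    apply: (eigenvalue_exp F0 B0 derD DE).
    rewrite -map_char_poly chiB (bigD1 r') //= rootM.
    by rewrite root_XsubC eqxx.
  have [||e' e'E] := @root_descend _ _ i (char_poly XE) e.
  - exact/monic_neq0/char_poly_monic.
  - by rewrite map_char_poly XEE.
  exists e'; rewrite -(fmorph_eq0 i) -e'E; split=> //.
have bf r : Qspan f (b r).
  apply/bspan; exists (fun s => (r == s)%:R); rewrite (bigD1 r) //= big1 ?addr0.
    by rewrite eqxx /ratr divr1 mul1r.
  by move=> s /negPf rs; rewrite eq_sym rs /ratr mul0r mul0r.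
(* A common denominator of the coordinates of b r, and the integral coordinates
   of its product by b r. *)
have /choice[Dz DzP] r : exists Dz : int * ('I_n -> int), Dz.1 != 0 /\
    Dz.1%:~R * b r = \sum_s f s *~ Dz.2 s.
  have [c ->] := bf r; have [Dr Dr0 [z zE]] := common_denominator c.
  exists (Dr, z); split=> //=; rewrite mulr_sumr; apply: eq_bigr => s _.
  by rewrite mulrA (ratr_common_denominator L0 (zE s)) mulrzl.
pose y r := \sum_s fE s *~ (Dz r).2 s.
pose z r := \prod_s e s ^ (Dz r).2 s.
have iy r : i (y r) = (Dz r).1%:~R * b r.
  rewrite (DzP r).2 rmorph_sum; apply: eq_bigr => s _ /=.
  by rewrite raddfMz /= -fEE.
have znz r : z r != 0.
  by apply/prodf_neq0 => s _; apply: expfz_neq0; have [] := eP s.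
have Dz_log s r : D s (i (z r)) = i (z r) * D s (i (y r)).
  transitivity (i (z r) * \sum_t D s (f t) *~ (Dz r).2 t).
    apply: (@logderiv_prod _ _ i (D s \o i) (derDi s)) => t.
    by apply: (logderivXz _ (derDi s)) => /=; have [_ ->] := eP t.
  congr (_ * _); rewrite /y rmorph_sum (derivation_sum (derD s)).
  apply: eq_bigr => t _; rewrite raddfMz /= -fEE.
  case: ((Dz r).2 t) => m; first by rewrite -!pmulrn (derivationMn (derD s)).
  by rewrite NegzE !mulrNz (derivationN (derD s)) -!pmulrn (derivationMn (derD s)).
have yfree (q : 'I_N -> int) c : \sum_r y r *~ q r = kappa c -> forall r, q r = 0.
  move=> yc; have c0 : c = 0.
    apply: (eigenvalue_combination (q := fun s => \sum_r (Dz r).2 s * q r) A0 chiE).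
    rewrite -ikappa -yc rmorph_sum.
    under eq_bigr do rewrite mulrz_sumr.
    rewrite exchange_big; apply: eq_bigr => r _ /=.
    rewrite raddfMz /= /y rmorph_sum mulrz_suml; apply: eq_bigr => s _ /=.
    by rewrite raddfMz /= -fEE mulrzA.
  have := congr1 i yc; rewrite c0 !rmorph0 rmorph_sum /= => rel r.
  have brel : \sum_t ratr ((Dz t).1 * q t)%:~R * b t = 0.
    rewrite -[RHS]rel; apply: eq_bigr => t _.
    by rewrite ratr_int raddfMz /= iy -mulrzr rmorphM /=; ring.
  have /eqP := bfree (fun t => ((Dz t).1 * q t)%:~R) brel r.
  by rewrite intr_eq0 mulf_eq0 (negPf (DzP r).1) /= => /eqP.
have constE y' : (forall s, (D s \o i) y' = 0) -> exists c, y' = kappa c.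
  move=> /Dconst[c yc]; exists c; apply: (fmorph_inj i).
  by rewrite ikappa.
have DC s c : (D s \o i) (kappa c) = 0.
  by rewrite /= ikappa DE fps_derivC !rmorph0.
have := abstract_ax E0 der_del delC delx genE derDi DC constE znz Dz_log yfree
  (fun r : 'I_(n * n) => mxvec AE 0 r).
suff -> : \matrix_(r < n * n, s < l) (D s \o i) (mxvec AE 0 r) = map_mx iota (jacobian A).
  by rewrite mxrank_map.
apply/matrixP=> r s; rewrite !mxE /=.
have -> : i (mxvec AE 0 r) = iota (tofrac (mxvec A 0 r)).
  have := congr1 (fun M : 'M[L]_n => mxvec M 0 r) AEE.
  by rewrite -!map_mxvec !mxE.
exact: DE.
Qed.

Theorem theorem8p1 (R : realType) (l n : nat) (A : 'M[{fps R[i][l]}]_n)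
  (A0 : forall i j, A i j 0%MM = 0)
  (L : closedFieldType) (iota : {rmorphism {fraction {fps R[i][l]}} -> L})
  (iota_alg : forall x : L, algebraicOver iota x)
  (f : 'I_n -> L)
  (f_eigen : char_poly (map_mx iota (map_mx (@tofrac _) A))
             = \prod_(i < n) ('X - (f i)%:P))
  (N : nat) (dimN : has_Qdim (Qspan f) N)
  (d : nat)
  (trdeg_d : has_trdeg (fun c : R[i] => tofrac (fpsC l c)) (field_mx_exp A) d) :
  (N + \rank (jacobian A) <= d)%N.
Proof.
apply: (@matrix_ax_schanuel R[i] L l n A iota f N d) => //.
exact: Num.Theory.pchar_num.
Qed.
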